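(* Let $n\ge 0$. If $(M,G,\mathcal I,\mathcal J,\mathcal K)$ is a twisted generalized hyperkähler $4n$-manifold and $D$ is the generalized Bismut connection, then the generalized almost complex structure $\mathbb J_D$ on the twistor space $\mathcal Z=M\times\mathbb S^2$ is integrable.
   Context: Everything is smooth. For a manifold $N$, $\mathbb T N=TN\oplus T^\star N$ carries the inner product $\langle X+\xi,Y+\eta\rangle=\frac12(\xi(Y)+\eta(X))$ and the Courant bracket $[X+\xi,Y+\eta]=[X,Y]+\mathcal L_X\eta-\mathcal L_Y\xi-\frac12 d(i_X\eta-i_Y\xi)$. For a closed real 3-form $h$, the $h$-twisted Courant bracket is $[X+\xi,Y+\eta]_h=[X+\xi,Y+\eta]+i_Yi_Xh$. A generalized almost complex structure is an endomorphism $\mathcal J$ of $\mathbb T N$ with $\mathcal J^2=-1$, $\mathcal J^\star=-\mathcal J$ (adjoint for $\langle\cdot,\cdot\rangle$). It is a twisted generalized complex structure with respect to $h$ (twisted integrable) if its $i$-eigenbundle in $\mathbb T N\otimes\mathbb C$ is involutive for $[\cdot,\cdot]_h$; it is called simply integrable when this holds with $h=0$, i.e. for the untwisted Courant bracket. A generalized metric on $M$ is a subbundle $C^+\subset\mathbb T M$ of rank $\dim M$ on which $\langle\cdot,\cdot\rangle$ is positive definite; $C^-$ is its orthogonal complement (negative definite), and $G$ denotes the endomorphism of $\mathbb T M$ equal to $\pm1$ on $C^\pm$. $(G,\mathcal J)$ is a twisted generalized Kähler structure if $\mathcal J$ commutes with $G$ and both $\mathcal J$ and $G\mathcal J$ are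 twisted generalized complex structures with respect to $h$. $(M,G,\mathcal I,\mathcal J,\mathcal K)$ is twisted generalized hyperkähler (with respect to $h$) if $\mathcal I\mathcal J=-\mathcal J\mathcal I=\mathcal K$ and each of $(G,\mathcal I),(G,\mathcal J),(G,\mathcal K)$ is a twisted generalized Kähler structure with respect to $h$. Generalized Bismut connection associated to $G$ (and $h$): write $\mathcal X=\mathcal X^++\mathcal X^-$ for the orthogonal projections of $\mathcal X\in\Gamma(\mathbb T M)$ to $C^\pm$, and let $C:\mathbb T M\to\mathbb T M$ be the automorphism $C(X+\xi)=X-\xi$. Then $D$ is the connection on $\mathbb T M$ $$D_{\mathcal X}\mathcal Y=[\mathcal X^-,\mathcal Y^+]_h^++[\mathcal X^+,\mathcal Y^-]_h^-+[C\mathcal X^-,\mathcal Y^-]_h^-+[C\mathcal X^+,\mathcal Y^+]_h^+,$$ where the superscripts $\pm$ on brackets denote the $C^\pm$ components. It preserves $\langle\cdot,\cdot\rangle$ and $G$, and for a twisted generalized hyperkähler structure $D\mathcal I=D\mathcal J=D\mathcal K=0$. Twistor space: $\mathcal Z=M\times\mathbb S^2=\{(m,a\mathcal I+b\mathcal J+c\mathcal K): (a,b,c)\in\mathbb S^2\}$, with first projection $\pi_{\mathcal Z}:\mathcal Z\to M$. Parallel transport of the elements $u$ of $\mathcal Z$ by $D$ gives $T\mathcal Z=\mathcal H\oplus\mathcal V$ (horizontal and vertical). Let $\mathcal H^\star$ (resp. $\mathcal V^\star$) be the covectors vanishing on $\mathcal V$ (resp. $\mathcal H$), so that $\mathbb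 T\mathcal Z=(\mathcal H\oplus\mathcal H^\star)\oplus(\mathcal V\oplus\mathcal V^\star)$. The projection $\pi_{\mathcal Z}$ identifies $\mathcal H\oplus\mathcal H^\star$ at $(m,u)$ isometrically with $\mathbb T_mM$, and $\mathbb J_D$ acts there as $u$. On $\mathcal V\oplus\mathcal V^\star$, where $\mathcal V$ is the tangent bundle to the fibres $\mathbb S^2$, $\mathbb J_D$ is the generalized complex structure given by the natural complex structure of $\mathbb C P^1$, i.e. $v\mapsto u\circ v$ for $v\in\mathrm{Vect}(\mathcal I,\mathcal J,\mathcal K)$ orthogonal to $u$ (with $(\mathcal I,\mathcal J,\mathcal K)$ orthonormal), and minus its transpose on $\mathcal V^\star$.
   Formalization: Integrability on Z is for the Courant bracket twisted by the pullback of h (untwisted fails for h≠0, e.g. on SU(2)×U(1)); and C is X+ξ↦X−ξ in the splitting where C^± are graphs of ±g, since otherwise D is not a connection. *)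

(* Defs.v *)
From mathcomp Require Import all_boot all_order all_algebra.
From mathcomp Require Import boolp classical_sets cardinality reals topology.
From mathcomp Require Import normedtype derive ring.

Set Implicit Arguments.
Unset Strict Implicit.
Unset Printing Implicit Defensive.

Import Order.TTheory GRing.Theory Num.Theory.
Import numFieldNormedType.Exports.

Local Open Scope classical_set_scope.
Local Open Scope ring_scope.

(* Conventions.  Points and tangent vectors of R^d are columns 'cV_d; a
   covector is the column of its components; an element X + xi of T (+) T^*
   is the column col_mx X xi : 'cV_(d + d); endomorphisms are square matrices
   acting on the left, so that A *m B is the composite "A after B". *)

Section Calculus.
Context {R : realType} {d : nat}.
Implicit Types (U : set 'cV[R]_d) (x v : 'cV[R]_d).

Fixpoint Ck (k : nat) U (f : 'cV[R]_d -> R) : Prop :=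
  if k is k'.+1 then
    (forall x, U x -> differentiable f x) /\
    (forall v, Ck k' U (fun x => 'D_v f x))
  else forall x, U x -> {for x, continuous f}.

Definition smooth U (f : 'cV[R]_d -> R) : Prop := forall k, Ck k U f.

Definition smooth_mx m n U (F : 'cV[R]_d -> 'M[R]_(m, n)) : Prop :=
  forall i j, smooth U (fun x => F x i j).

Definition ddir m n (v : 'cV[R]_d) (F : 'cV[R]_d -> 'M[R]_(m, n)) x
  : 'M[R]_(m, n) := \matrix_(i, j) 'D_v (fun y => F y i j) x.

Definition basis_vec (k : 'I_d) : 'cV[R]_d := delta_mx k 0.

Definition grad (f : 'cV[R]_d -> R) x : 'cV[R]_d :=
  \col_k 'D_(basis_vec k) f x.

Definition jac m (F : 'cV[R]_d -> 'cV[R]_m) x : 'M[R]_(m, d) :=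
  \matrix_(i, k) 'D_(basis_vec k) (fun y => F y i 0) x.

Definition dotv (xi X : 'cV[R]_d) : R := (xi^T *m X) 0 0.

End Calculus.

Section Manifolds.
Context {R : realType}.

(* Coordinate systems are presented by injective parametrizations of the
   points of N by open subsets of R^d; the topology of N is the one they
   induce. *)
Record atlas (d : nat) (N : Type) := Atlas {
  chart : Type;
  adom : chart -> set 'cV[R]_d;
  apar : chart -> 'cV[R]_d -> N;
  acoord : chart -> N -> 'cV[R]_d }.

Section Laws.
Context {d : nat} {N : Type} (A : atlas d N).

Definition overlap (i j : chart A) : set 'cV[R]_d :=
  [set x | adom i x /\ exists2 y, adom j y & apar j y = apar i x].

Definition transition (i j : chart A) (x : 'cV[R]_d) : 'cV[R]_d :=
  acoord j (apar i x).

Definition aopen (U : set N) : Prop :=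
  forall i : chart A, open [set x | adom i x /\ U (apar i x)].

Record smooth_manifold : Prop := SmoothManifold {
  adom_open : forall i : chart A, open (adom i);
  aparK : forall (i : chart A) x, adom i x -> acoord i (apar i x) = x;
  acover : forall p, exists i : chart A, exists2 x, adom i x & apar i x = p;
  overlap_open : forall i j, open (overlap i j);
  transition_smooth : forall i j, smooth_mx (overlap i j) (transition i j);
  ahausdorff : forall p q, p <> q -> exists U V : set N,
    [/\ aopen U, aopen V, U p, V q & U `&` V = set0];
  asecond_countable : exists B : set (set N),
    [/\ countable B, B `<=` aopen &
     forall U p, aopen U -> U p -> exists2 V, B V & V p /\ V `<=` U] }.

End Laws.

Definition prod_atlas d d' N N' (A : atlas d N) (A' : atlas d' N') :
    atlas (d + d') (N * N') :=
  @Atlas (d + d') (N * N') (chart A * chart A')%type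
    (fun i => [set z | adom i.1 (usubmx z) /\ adom i.2 (dsubmx z)])
    (fun i z => (apar i.1 (usubmx z), apar i.2 (dsubmx z)))
    (fun i p => col_mx (acoord i.1 p.1) (acoord i.2 p.2)).

End Manifolds.
Arguments atlas R d N : clear implicits.

Section CourantLocal.
Context {R : realType} {d : nat}.

Definition tsec := 'cV[R]_d -> 'cV[R]_(d + d).
Definition form3 := 'cV[R]_d -> 'cV[R]_d -> 'cV[R]_d -> R.

Definition pairing (s t : 'cV[R]_(d + d)) : R :=
  2^-1 * (dotv (dsubmx s) (usubmx t) + dotv (dsubmx t) (usubmx s)).

Definition lie (X Y : 'cV[R]_d -> 'cV[R]_d) (x : 'cV[R]_d) : 'cV[R]_d :=
  ddir (X x) Y x - ddir (Y x) X x.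

(* (L_X eta)_k = X^i d_i eta_k + eta_i d_k X^i *)
Definition lieD (X eta : 'cV[R]_d -> 'cV[R]_d) (x : 'cV[R]_d) : 'cV[R]_d :=
  ddir (X x) eta x + (jac X x)^T *m eta x.

Definition iprod3 (h : form3) (X Y : 'cV[R]_d) : 'cV[R]_d :=
  \col_k h X Y (basis_vec k).

Definition courant (h : 'cV[R]_d -> form3) (s t : tsec) : tsec := fun x =>
  let X := fun y => usubmx (s y) in let xi := fun y => dsubmx (s y) in
  let Y := fun y => usubmx (t y) in let eta := fun y => dsubmx (t y) in
  col_mx (lie X Y x)
    (lieD X eta x - lieD Y xi x
     - 2^-1 *: grad (fun y => dotv (eta y) (X y) - dotv (xi y) (Y y)) x
     + iprod3 (h x) (X x) (Y x)).

(* A section a + i b of the complexification is the pair (a, b) of its real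
   and imaginary parts; the bracket is extended complex-bilinearly. *)
Definition ctsec := (tsec * tsec)%type.

Definition ccourant (h : 'cV[R]_d -> form3) (s t : ctsec) : ctsec :=
  ((fun x => courant h s.1 t.1 x - courant h s.2 t.2 x),
   (fun x => courant h s.1 t.2 x + courant h s.2 t.1 x)).

Definition csmooth (U : set 'cV[R]_d) (s : ctsec) : Prop :=
  smooth_mx U s.1 /\ smooth_mx U s.2.

(* J (a + i b) = i (a + i b) at every point of U *)
Definition in_ieigen (J : 'cV[R]_d -> 'M[R]_(d + d)) (U : set 'cV[R]_d)
    (s : ctsec) : Prop :=
  forall x, U x -> J x *m s.1 x = - s.2 x /\ J x *m s.2 x = s.1 x.

End CourantLocal.
Arguments tsec R d : clear implicits.
Arguments form3 R d : clear implicits.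
Arguments ctsec R d : clear implicits.

Section TensorFields.
Context {R : realType} {d : nat} {N : Type} (A : atlas R d N).

(* Tensor fields are given by their components in every chart. *)
Definition endo_field := chart A -> 'cV[R]_d -> 'M[R]_(d + d).
Definition form3_field := chart A -> 'cV[R]_d -> form3 R d.

(* the action of a change of coordinates on T (+) T^* *)
Definition tchange (i j : chart A) (x : 'cV[R]_d) : 'M[R]_(d + d) :=
  let P := jac (transition i j) x in block_mx P 0 0 (invmx P)^T.

Definition is_endo_field (J : endo_field) : Prop :=
  (forall i, smooth_mx (adom i) (J i)) /\
  (forall i j x, overlap i j x ->
     J j (transition i j x) *m tchange i j x = tchange i j x *m J i x).

Definition alt_trilinear (w : form3 R d) : Prop :=
  [/\ forall a X X' Y Z, w (a *: X + X') Y Z = a * w X Y Z + w X' Y Z,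
      forall X Y Z, w X Y Z = - w Y X Z &
      forall X Y Z, w X Y Z = - w X Z Y].

Definition is_form3_field (h : form3_field) : Prop :=
  [/\ forall i x, adom i x -> alt_trilinear (h i x),
      forall i X Y Z, smooth (adom i) (fun x => h i x X Y Z) &
      forall i j x, overlap i j x -> forall X Y Z,
        h i x X Y Z = h j (transition i j x) (jac (transition i j) x *m X)
          (jac (transition i j) x *m Y) (jac (transition i j) x *m Z)].

(* dh evaluated on constant vector fields of a chart *)
Definition closed_form3 (h : form3_field) : Prop :=
  forall i x, adom i x -> forall X Y Z W : 'cV[R]_d,
    'D_X (fun y => h i y Y Z W) x - 'D_Y (fun y => h i y X Z W) x
    + 'D_Z (fun y => h i y X Y W) x - 'D_W (fun y => h i y X Y Z) x = 0.

Definition gen_almost_complex (J : endo_field) : Prop :=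
  [/\ is_endo_field J,
      forall i x, adom i x -> J i x *m J i x = - 1%:M &
      forall i x, adom i x -> forall s t,
        pairing (J i x *m s) t = - pairing s (J i x *m t)].

(* Involutivity is a local property: it is tested on sections over the open
   subsets of the coordinate domains. *)
Definition twisted_integrable (h : form3_field) (J : endo_field) : Prop :=
  forall (i : chart A) (U : set 'cV[R]_d), open U -> U `<=` adom i ->
  forall s t : ctsec R d, csmooth U s -> csmooth U t ->
    in_ieigen (J i) U s -> in_ieigen (J i) U t ->
    in_ieigen (J i) U (ccourant (h i) s t).

Definition twisted_gen_complex (h : form3_field) (J : endo_field) : Prop :=
  gen_almost_complex J /\ twisted_integrable h J.

Definition Cplus (G : 'M[R]_(d + d)) : set 'cV[R]_(d + d) :=
  [set s | G *m s = s].

Definition gen_metric (G : endo_field) : Prop :=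
  is_endo_field G /\
  forall i x, adom i x ->
    [/\ \rank (eigenspace (G i x)^T 1) = d,
        forall s, Cplus (G i x) s -> s != 0 -> 0 < pairing s s &
        forall t, (forall s, Cplus (G i x) s -> pairing s t = 0) ->
          G i x *m t = - t].

Definition mulE (F H : endo_field) : endo_field := fun i x => F i x *m H i x.

Definition twisted_gen_kahler (h : form3_field) (G J : endo_field) : Prop :=
  [/\ gen_metric G,
      forall i x, adom i x -> mulE J G i x = mulE G J i x,
      twisted_gen_complex h J & twisted_gen_complex h (mulE G J)].

Definition twisted_gen_hyperkahler (h : form3_field) (G I J K : endo_field)
    : Prop :=
  [/\ forall i x, adom i x ->
        mulE I J i x = K i x /\ mulE J I i x = - K i x,
      twisted_gen_kahler h G I, twisted_gen_kahler h G J &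
      twisted_gen_kahler h G K].

End TensorFields.

Section Bismut.
Context {R : realType} {d : nat}.
Context (h : 'cV[R]_d -> form3 R d) (G : 'cV[R]_d -> 'M[R]_(d + d)).
Implicit Types (s t : tsec R d).

Definition projp s : tsec R d := fun x => 2^-1 *: (s x + G x *m s x).
Definition projm s : tsec R d := fun x => 2^-1 *: (s x - G x *m s x).

(* If C^+ is the graph of b + g, with b a 2-form and g a metric, then
   G = e^b [0 g^-1; g 0] e^-b, where e^b (X + xi) = X + xi + b X. *)
Definition bfield (G : 'M[R]_(d + d)) : 'M[R]_d :=
  - (invmx (ursubmx G) *m ulsubmx G).
Definition expB (b : 'M[R]_d) : 'M[R]_(d + d) := block_mx 1%:M 0 b 1%:M.

(* X + xi |-> X - xi in the splitting of T (+) T^* determined by the metric,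
   in which C^+ and C^- are the graphs of g and -g; this C exchanges C^+ and
   C^-.  When b = 0 it is X + xi |-> X - xi itself, see reflC_graph. *)
Definition reflC (G : 'M[R]_(d + d)) : 'M[R]_(d + d) :=
  expB (bfield G) *m block_mx 1%:M 0 0 (- 1%:M) *m expB (- bfield G).

Definition bismut s t : tsec R d := fun x =>
  let Cp := fun y => reflC (G y) *m projp s y in
  let Cm := fun y => reflC (G y) *m projm s y in
  projp (courant h (projm s) (projp t)) x
  + projm (courant h (projp s) (projm t)) x
  + projm (courant h Cm (projm t)) x
  + projp (courant h Cp (projp t)) x.

(* D_v J applied to y, at the point x; v and y are extended by constants, and
   the vector v is seen in T (+) T^*. *)
Definition bismut_endo (J : 'cV[R]_d -> 'M[R]_(d + d)) (x v : 'cV[R]_d)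
    (y : 'cV[R]_(d + d)) : 'cV[R]_(d + d) :=
  bismut (fun=> col_mx v 0) (fun x' => J x' *m y) x
  - J x *m bismut (fun=> col_mx v 0) (fun=> y) x.

End Bismut.

Lemma reflC_graph (R : realType) (d : nat) (G : 'M[R]_(d + d)) :
  ulsubmx G = 0 -> reflC G = block_mx 1%:M 0 0 (- 1%:M).
Proof.
move=> G0; rewrite /reflC /bfield G0 mulmx0 oppr0 /expB oppr0.
by rewrite -scalar_mx_block mul1mx mulmx1.
Qed.

Lemma bfield_graph (R : realType) (d : nat) (b g : 'M[R]_d) : g \in unitmx ->
  bfield (expB b *m block_mx 0 (invmx g) g 0 *m expB (- b)) = b.
Proof.
move=> gU; rewrite /bfield /expB !mulmx_block block_mxKur block_mxKul.
rewrite !(mul0mx, mulmx0, mul1mx, mulmx1, addr0, add0r).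
by rewrite invmxK mulmxN mulmxN opprK mulmxA mulmxV // mul1mx.
Qed.

Section Sphere.
Context {R : realType}.

Definition sphere := {u : 'cV[R]_3 | u^T *m u == 1%:M}.

Definition col3 (a b c : R) : 'cV[R]_3 := \col_i nth 0 [:: a; b; c] i.

Definition cross (u v : 'cV[R]_3) : 'cV[R]_3 :=
  let c k := u (inord k) 0 in let e k := v (inord k) 0 in
  col3 (c 1%N * e 2%N - c 2%N * e 1%N) (c 2%N * e 0%N - c 0%N * e 2%N)
       (c 0%N * e 1%N - c 1%N * e 0%N).

(* inverse stereographic projection from the pole (0, 0, (-1)^e) *)
Definition pole (e : bool) : R := (-1) ^+ e.
Definition stereo_inv (e : bool) (z : 'cV[R]_2) : 'cV[R]_3 :=
  let r := z 0 0 ^+ 2 + z 1 0 ^+ 2 in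
  (1 + r)^-1 *: col3 (2 * z 0 0) (2 * z 1 0) (pole e * (r - 1)).

Definition stereo (e : bool) (u : 'cV[R]_3) : 'cV[R]_2 :=
  (1 - pole e * u (inord 2) 0)^-1 *:
    \col_i nth 0 [:: u (inord 0) 0; u (inord 1) 0] i.

Lemma stereo_inv_sphere e z :
  (stereo_inv e z)^T *m stereo_inv e z == 1%:M.
Proof.
apply/eqP/matrixP => i j; rewrite !ord1 !mxE eqxx /=.
rewrite !big_ord_recl big_ord0 !mxE /= addr0.
set a := z 0 0; set b := z 1 0; set r := a ^+ 2 + b ^+ 2.
have r0 : 1 + r != 0 by rewrite lt0r_neq0 // ltr_pwDl ?ltr01 // addr_ge0 ?sqr_ge0.
have e2 : pole e ^+ 2 = 1 by rewrite /pole sqrr_sign.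
transitivity ((1 + r)^-1 ^+ 2 * (4 * r + pole e ^+ 2 * (r - 1) ^+ 2)).
  by rewrite /r; ring.
by rewrite e2 /r; field.
Qed.

Definition sphere_atlas : atlas R 2 sphere :=
  @Atlas R 2 sphere bool (fun _ => setT)
    (fun e z => exist _ (stereo_inv e z) (stereo_inv_sphere e z))
    (fun e u => stereo e (val u)).

(* The complex structure v |-> u o v of the fibre S^2 at u = stereo_inv e z:
   for orthogonal imaginary unit quaternions the product is the cross product
   of their coordinates in (I, J, K).  The differential of stereo_inv e
   identifies R^2 with the orthogonal of u. *)
Definition fibreJ (e : bool) (z : 'cV[R]_2) : 'M[R]_2 :=
  xget 0 [set B : 'M[R]_2 | forall w,
    jac (stereo_inv e) z *m (B *m w)
    = cross (stereo_inv e z) (jac (stereo_inv e) z *m w)].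

End Sphere.
Arguments sphere R : clear implicits.
Arguments sphere_atlas R : clear implicits.

Section TwistorLocal.
Context {R : realType} {d : nat}.

Definition quat m (I J K : 'M[R]_m) (a : 'cV[R]_3) : 'M[R]_m :=
  a (inord 0) 0 *: I + a (inord 1) 0 *: J + a (inord 2) 0 *: K.

(* The matrix L of the horizontal lift T_m M -> T_u S^2 in coordinates
   (x, z): a curve (m(t), u(t)) of the twistor space with velocity (v, L v)
   satisfies the equation D_v u = 0 of parallel transport, i.e.
   a' I + b' J + c' K + a D_v I + b D_v J + c D_v K = 0. *)
Definition hlift (h : 'cV[R]_d -> form3 R d)
    (G I J K : 'cV[R]_d -> 'M[R]_(d + d)) (e : bool)
    (x : 'cV[R]_d) (z : 'cV[R]_2) : 'M[R]_(2, d) :=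
  let u := stereo_inv e z in
  xget 0 [set L : 'M[R]_(2, d) | forall v y,
    quat (I x) (J x) (K x) (jac (stereo_inv e) z *m (L *m v)) *m y
    + (u (inord 0) 0 *: bismut_endo h G I x v y
       + u (inord 1) 0 *: bismut_endo h G J x v y
       + u (inord 2) 0 *: bismut_endo h G K x v y) = 0].

(* The isomorphism (T_m M (+) T_m^* M) (+) (V (+) V^* ) -> T Z (+) T^* Z given
   by the splitting TZ = H (+) V, where H is the graph of L, and its inverse:
   ((X, xi), (w, eta)) |-> ((X, L X + w), (xi - L^T eta, eta)). *)
Definition glue (L : 'M[R]_(2, d)) :
    'M[R]_((d + 2) + (d + 2), (d + d) + (2 + 2)) :=
  block_mx (block_mx 1%:M 0 L 0) (block_mx 0 0 1%:M 0)
           (block_mx 0 1%:M 0 0) (block_mx 0 (- L^T) 0 1%:M).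

Definition unglue (L : 'M[R]_(2, d)) :
    'M[R]_((d + d) + (2 + 2), (d + 2) + (d + 2)) :=
  block_mx (block_mx 1%:M 0 0 0) (block_mx 0 0 1%:M L^T)
           (block_mx (- L) 1%:M 0 0) (block_mx 0 0 0 1%:M).

Lemma glueK (L : 'M[R]_(2, d)) : unglue L *m glue L = 1%:M.
Proof.
rewrite /glue /unglue !mulmx_block !(mul0mx, mulmx0, mul1mx, mulmx1, addr0, add0r).
rewrite !add_block_mx !(mul0mx, mulmx0, mul1mx, mulmx1, addr0, add0r).
by rewrite !addNr -!scalar_mx_block !block_mx0 -scalar_mx_block.
Qed.

Lemma unglueK (L : 'M[R]_(2, d)) : glue L *m unglue L = 1%:M.
Proof.
rewrite /glue /unglue !mulmx_block !(mul0mx, mulmx0, mul1mx, mulmx1, addr0, add0r).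
rewrite !add_block_mx !(mul0mx, mulmx0, mul1mx, mulmx1, addr0, add0r).
by rewrite !subrr -!scalar_mx_block !block_mx0 -scalar_mx_block.
Qed.

End TwistorLocal.

Section Twistor.
Context {R : realType} {d : nat} {M : Type} (A : atlas R d M).

Definition twistor_atlas : atlas R (d + 2) (M * sphere R) :=
  prod_atlas A (sphere_atlas R).

(* The pullback of h by the projection Z -> M.  It is the twist with respect
   to which the twistor structure can be integrable: horizontal sections over
   a slice M x {u} have the bracket of M, and M x {u} carries the h-twisted
   structure u.  When h = 0 the twist is 0 and the bracket on Z is the
   untwisted Courant bracket. *)
Definition twistor_form (h : form3_field A) : form3_field twistor_atlas :=
  fun i q X Y Z => h i.1 (usubmx q) (usubmx X) (usubmx Y) (usubmx Z).

Definition twistor_structure (h : form3_field A) (G I J K : endo_field A) :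
    endo_field twistor_atlas := fun i q =>
  let x := usubmx q in let z := dsubmx q in
  let L := hlift (h i.1) (G i.1) (I i.1) (J i.1) (K i.1) i.2 x z in
  let u := quat (I i.1 x) (J i.1 x) (K i.1 x) (stereo_inv i.2 z) in
  let B := fibreJ i.2 z in
  glue L *m block_mx u 0 0 (block_mx B 0 0 (- B^T)) *m unglue L.

End Twistor.

(* Main.v *)
Require Import Defs.
From mathcomp Require Import all_boot all_order all_algebra reals.
From mathcomp Require Import boolp classical_sets functions topology.
From mathcomp Require Import normedtype landau derive ring.

Set Implicit Arguments.
Unset Strict Implicit.
Unset Printing Implicit Defensive.

Import Order.TTheory GRing.Theory Num.Theory.
Import numFieldNormedType.Exports.

Local Open Scope classical_set_scope.
Local Open Scope ring_scope.

(** In local coordinates, a section of the complexification lies in the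
    i-eigenbundle of J exactly when it is a - i J a for a real section a, and
    two such sections have their bracket in the eigenbundle exactly when
      N(a, b) = J ([a, b] - [J a, J b]) - [a, J b] - [J a, b]
    vanishes.  This N is a tensor, even for the Courant bracket, because J is
    orthogonal for the pairing ([nijenhuis_bracket]): at a point it is a
    trilinear expression in a, b, c and the first derivatives of J.
    Integrability is thus a pointwise condition, which is proved for the
    twistor space in three steps.

    The horizontal distribution is the product one.  On a Kaehler chart the
    i-eigenbundles of J and G J are L+ + L- and L+ + conj L-, with L+ and L-
    contained in the complexifications of C^+ and C^-.  Involutivity of both
    shows that the C^+ part of the bracket of a section of C^- with a section
    of C^+ commutes with J in the second argument, and likewise with the signs
    exchanged ([kahler_bracket]).  Each term of the Bismut connection is of
    this form, whence D I = D J = D K = 0 ([bismut_endo_eq0]); the equation of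
    parallel transport then forces the lift L to be 0 ([hlift_eq0]).

    Every u = a I + b J + c K with (a, b, c) in the sphere is integrable on M
    ([nijenhuis_combo]): N is quadratic in u, and its mixed terms vanish by
    linear algebra from N_I = N_J = N_K = 0 applied to sections moved by I, J
    and K ([nijenhuis_mixed]).

    On the twistor space the structure is therefore u(z) + B, where B is the
    complex structure of the sphere.  In a stereographic chart B is a constant
    rotation by a right angle ([fibreJE]), so the only new derivative is that
    of u along the fibre.  The terms of N containing it cancel because
    z |-> u(z) is holomorphic, that is, its derivative q satisfies
    q (B w) = u q (w) ([nijenhuis_split]); what is left is the tensor of u on
    M for a fixed z, which is zero. *)

(** * Differentiation of matrix-valued functions *)

(** [g - f] vanishes near [x], so it is differentiable there, with differential
    zero. *)
Lemma differentiable_near (R : numFieldType) (V W : normedModType R)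
    (f g : V -> W) (x : V) :
  (\near x, f x = g x) -> differentiable f x -> differentiable g x.
Proof.
move=> fg df.
suff dk : differentiable (g - f) x.
  have -> : g = (g - f) + f by apply/funext => y; rewrite /= fctE subrK.
  exact: differentiableD.
have k0 : (g - f) \o shift x = cst ((g - f) x) + (0 : V -> W) +o_ 0 id.
  apply/eqaddoP => e e0; rewrite nearE.
  have := fg; rewrite (near_shift 0) /= subr0 => fg0.
  apply: filterS fg0 => y /= fy.
  rewrite !fctE /= fy (nbhs_singleton fg) !subrr !addr0 subrr normr0.
  by rewrite mulr_ge0 // ltW.
have d0 : 'd (g - f) x = 0 :> (V -> W).
  by apply/diff_unique => //; exact: cst_continuous.
apply/diff_locallyP; rewrite d0; split => //; exact: cst_continuous.
Qed.

Section MatrixCalculus.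
Context {R : realType} {d : nat}.
Implicit Types (x v w : 'cV[R]_d) (f g : 'cV[R]_d -> R).

(** Differentiability is asked entry by entry, as [ddir] and [smooth_mx] are
    defined by entries. *)
Definition mxdiff m n (F : 'cV[R]_d -> 'M[R]_(m, n)) x : Prop :=
  forall i j, differentiable (fun y => F y i j) x.

Lemma derive_lin f x a v w : differentiable f x ->
  'D_(a *: v + w) f x = a * 'D_v f x + 'D_w f x.
Proof. by move=> df; rewrite !deriveE // linearP. Qed.

Lemma ddir_lin m n (F : 'cV[R]_d -> 'M[R]_(m, n)) x a v w : mxdiff F x ->
  ddir (a *: v + w) F x = a *: ddir v F x + ddir w F x.
Proof. by move=> dF; apply/matrixP => i j; rewrite !mxE derive_lin. Qed.

Lemma ddir_near m n (F G : 'cV[R]_d -> 'M[R]_(m, n)) x v :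
  (\near x, F x = G x) -> ddir v F x = ddir v G x.
Proof.
move=> FG; apply/matrixP => i j; rewrite !mxE; apply: near_eq_derive.
by apply: filterS FG => y ->.
Qed.

Lemma mxdiff_near m n (F G : 'cV[R]_d -> 'M[R]_(m, n)) x :
  (\near x, F x = G x) -> mxdiff F x -> mxdiff G x.
Proof.
move=> FG dF i j; apply: differentiable_near (dF i j).
by apply: filterS FG => y ->.
Qed.

Lemma mxdiff_cst m n (F : 'M[R]_(m, n)) x : mxdiff (fun=> F) x.
Proof. by move=> i j; exact: differentiable_cst. Qed.

Lemma ddir_cst m n (F : 'M[R]_(m, n)) x v : ddir v (fun=> F) x = 0.
Proof. by apply/matrixP => i j; rewrite !mxE derive_cst. Qed.

Lemma mxdiff_lin m n (F G : 'cV[R]_d -> 'M[R]_(m, n)) a x :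
  mxdiff F x -> mxdiff G x -> mxdiff (fun y => a *: F y + G y) x.
Proof.
move=> dF dG i j.
have -> : (fun y => (a *: F y + G y) i j) =
   (a *: (fun y => F y i j)) + (fun y => G y i j).
  by apply/funext => y; rewrite !mxE.
by apply: differentiableD (dG i j); exact: differentiableZ.
Qed.

Lemma ddir_linr m n (F G : 'cV[R]_d -> 'M[R]_(m, n)) a x v :
  mxdiff F x -> mxdiff G x ->
  ddir v (fun y => a *: F y + G y) x = a *: ddir v F x + ddir v G x.
Proof.
move=> dF dG; apply/matrixP => i j; rewrite !mxE.
have -> : (fun y => (a *: F y + G y) i j) =
   (a *: (fun y => F y i j)) + (fun y => G y i j).
  by apply/funext => y; rewrite !mxE.
have dFv := diff_derivable (v := v) (dF i j).
have dGv := diff_derivable (v := v) (dG i j).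
by rewrite (deriveD (derivableZ (k := a) dFv) dGv) (deriveZ _ dFv).
Qed.

Lemma mxdiffN m n (F : 'cV[R]_d -> 'M[R]_(m, n)) x : mxdiff F x ->
  mxdiff (fun y => - F y) x.
Proof.
move=> dF; have -> : (fun y => - F y) = (fun y => -1 *: F y + 0).
  by apply/funext => y; rewrite scaleN1r addr0.
exact: mxdiff_lin dF (mxdiff_cst 0 x).
Qed.

Lemma mxdiff_mul m n p (F : 'cV[R]_d -> 'M[R]_(m, n)) (G : 'cV[R]_d -> 'M[R]_(n, p))
  x : mxdiff F x -> mxdiff G x -> mxdiff (fun y => F y *m G y) x.
Proof.
move=> dF dG i j.
have -> : (fun y => (F y *m G y) i j) =
   \sum_k (fun y => F y i k) * (fun y => G y k j).
  by apply/funext => y; rewrite !mxE fct_sumE.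
apply: differentiable_sum => k; exact: differentiableM.
Qed.

Lemma ddir_mul m n p (F : 'cV[R]_d -> 'M[R]_(m, n)) (G : 'cV[R]_d -> 'M[R]_(n, p))
  x v : mxdiff F x -> mxdiff G x ->
  ddir v (fun y => F y *m G y) x = ddir v F x *m G x + F x *m ddir v G x.
Proof.
move=> dF dG; apply/matrixP => i j; rewrite !mxE.
have -> : (fun y => (F y *m G y) i j) =
   \sum_k (fun y => F y i k) * (fun y => G y k j).
  by apply/funext => y; rewrite !mxE fct_sumE.
have dFv k := diff_derivable (v := v) (dF i k).
have dGv k := diff_derivable (v := v) (dG k j).
rewrite derive_sum => [|k]; last exact: derivableM.
rewrite -big_split; apply: eq_bigr => k _ /=.
rewrite deriveM // !mxE addrC; congr (_ + _); first by rewrite mulrC.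
Qed.

End MatrixCalculus.

Section ScalarProduct.
Context {R : realType} {d : nat}.

Lemma mxdiff_scale m n (f : 'cV[R]_d -> R) (F : 'cV[R]_d -> 'M[R]_(m, n)) x :
  differentiable f x -> mxdiff F x -> mxdiff (fun y => f y *: F y) x.
Proof.
move=> df dF i j.
rewrite (_ : (fun y => _) = f * (fun y => F y i j)); first exact: differentiableM.
by apply/funext => y; rewrite mxE.
Qed.

Lemma ddir_scale m n (f : 'cV[R]_d -> R) (F : 'cV[R]_d -> 'M[R]_(m, n)) x v :
  differentiable f x -> mxdiff F x ->
  ddir v (fun y => f y *: F y) x = f x *: ddir v F x + 'D_v f x *: F x.
Proof.
move=> df dF; apply/matrixP => i j; rewrite !mxE.
rewrite (_ : (fun y => _) = f * (fun y => F y i j)).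
  rewrite deriveM; [|exact: diff_derivable|exact/diff_derivable/dF].
  by rewrite [F x i j *: _]mulrC.
by apply/funext => y; rewrite mxE.
Qed.

Lemma mxdiffD m n (F H : 'cV[R]_d -> 'M[R]_(m, n)) x :
  mxdiff F x -> mxdiff H x -> mxdiff (fun y => F y + H y) x.
Proof.
move=> dF dH; rewrite (_ : (fun y => _) = fun y => 1 *: F y + H y).
  exact: mxdiff_lin.
by apply/funext => y; rewrite scale1r.
Qed.

Lemma ddirD m n (F H : 'cV[R]_d -> 'M[R]_(m, n)) x v :
  mxdiff F x -> mxdiff H x ->
  ddir v (fun y => F y + H y) x = ddir v F x + ddir v H x.
Proof.
move=> dF dH; rewrite (_ : (fun y => _) = fun y => 1 *: F y + H y).
  by rewrite ddir_linr // scale1r.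
by apply/funext => y; rewrite scale1r.
Qed.

End ScalarProduct.

Section ProductCalculus.
Context {R : realType} {d k : nat}.
Implicit Types (q v : 'cV[R]_(d + k)).

Lemma continuous_usubmx : continuous (usubmx : 'cV[R]_(d + k) -> 'cV[R]_d).
Proof.
move=> u A /nbhs_ballP[e /= e0 eA].
apply/nbhs_ballP; exists e => //= v [_ uv]; apply: eA; split => // i j.
by apply: (le_lt_trans _ (uv (lshift k i) j)); rewrite !mxE.
Qed.

Lemma continuous_dsubmx : continuous (dsubmx : 'cV[R]_(d + k) -> 'cV[R]_k).
Proof.
move=> u A /nbhs_ballP[e /= e0 eA].
apply/nbhs_ballP; exists e => //= v [_ uv]; apply: eA; split => // i j.
by apply: (le_lt_trans _ (uv (rshift d i) j)); rewrite !mxE.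
Qed.

Lemma mxdiff_comp_usubmx m n (F : 'cV[R]_d -> 'M[R]_(m, n)) q :
  mxdiff F (usubmx q) -> mxdiff (fun q => F (usubmx q)) q.
Proof.
move=> dF i j; apply: (@differentiable_comp _ _ _ _ usubmx (fun x => F x i j)).
  by apply: linear_differentiable; exact: continuous_usubmx.
exact: dF.
Qed.

Lemma mxdiff_comp_dsubmx m n (F : 'cV[R]_k -> 'M[R]_(m, n)) q :
  mxdiff F (dsubmx q) -> mxdiff (fun q => F (dsubmx q)) q.
Proof.
move=> dF i j; apply: (@differentiable_comp _ _ _ _ dsubmx (fun x => F x i j)).
  by apply: linear_differentiable; exact: continuous_dsubmx.
exact: dF.
Qed.

Lemma ddir_comp_usubmx m n (F : 'cV[R]_d -> 'M[R]_(m, n)) q v :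
  ddir v (fun q => F (usubmx q)) q = ddir (usubmx v) F (usubmx q).
Proof.
apply/matrixP => i j; rewrite !mxE /derive.
rewrite [X in X @ _](_ : _ = fun t : R =>
    t^-1 *: (F (t *: usubmx v + usubmx q) i j - F (usubmx q) i j)) //.
apply/funext => t /=; congr (_ *: (F _ i j - _)).
by apply/matrixP => r c; rewrite !mxE.
Qed.

Lemma ddir_comp_dsubmx m n (F : 'cV[R]_k -> 'M[R]_(m, n)) q v :
  ddir v (fun q => F (dsubmx q)) q = ddir (dsubmx v) F (dsubmx q).
Proof.
apply/matrixP => i j; rewrite !mxE /derive; rewrite [X in X @ _](_ : _ = fun t : R =>
    t^-1 *: (F (t *: dsubmx v + dsubmx q) i j - F (dsubmx q) i j)) //.
apply/funext => t /=; congr (_ *: (F _ i j - _)).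
by apply/matrixP => r c; rewrite !mxE.
Qed.

End ProductCalculus.

Section Smooth.
Context {R : realType} {d : nat}.
Implicit Types (U : set 'cV[R]_d) (f g : 'cV[R]_d -> R).

Lemma near_open (T : Type) U (F G : 'cV[R]_d -> T) x :
  open U -> U x -> (forall y, U y -> F y = G y) -> \near x, F x = G x.
Proof. by move=> oU Ux FG; apply: filterS FG _; exact: open_nbhs_nbhs. Qed.

(** Derivatives of order two of a sum on [U] need this: the first derivatives
    of [f + g] and the sum of those of [f] and [g] agree on [U] only. *)
Lemma Ck_eq k U f g : open U -> (forall x, U x -> f x = g x) ->
  Ck k U f -> Ck k U g.
Proof.
move=> oU; elim: k f g => [|k IH] f g fg /=.
  move=> cf x Ux; have nfg := near_open oU Ux fg.
  have cfx : f @ x --> g x by rewrite -(nbhs_singleton nfg); exact: cf.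
  by apply: cvg_trans cfx; exact: near_eq_cvg nfg.
move=> [df Df]; split=> [x Ux|v].
  exact: differentiable_near (near_open oU Ux fg) (df x Ux).
apply: IH (Df v) => x Ux; apply: near_eq_derive; exact: near_open oU Ux fg.
Qed.

Lemma Ck_lin k U a f g : open U -> Ck k U f -> Ck k U g ->
  Ck k U (fun x => a * f x + g x).
Proof.
move=> oU; elim: k f g => [|k IH] f g /=.
  move=> cf cg x Ux; apply: cvgD (cg x Ux).
  by apply: cvgM (cf x Ux); exact: cvg_cst.
move=> [df Df] [dg Dg].
have dZ x : U x -> differentiable (a *: f) x by move=> Ux; exact/differentiableZ/df.
split=> [x Ux|v].
  exact: (differentiableD (dZ x Ux) (dg x Ux)).
apply: (@Ck_eq _ _ (fun x => a * 'D_v f x + 'D_v g x)) => // [x Ux|]; last exact: IH.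
have -> : (fun x => a * f x + g x) = (a *: f) + g by [].
rewrite deriveD ?deriveZ //; first exact/diff_derivable/df.
  exact/diff_derivable/dZ.
exact/diff_derivable/dg.
Qed.

Lemma smooth_cst U (a : R) : smooth U (fun=> a).
Proof.
move=> k; elim: k a => [|k IH] a /=; first by move=> x _; exact: cst_continuous.
split=> [x _|v]; first exact: differentiable_cst.
have -> : (fun x => 'D_v (fun=> a) x) = fun=> 0 by apply/funext => x; rewrite derive_cst.
exact: IH.
Qed.

Lemma smooth_mulmx_cst U m n p (F : 'cV[R]_d -> 'M[R]_(m, n)) (a : 'M[R]_(n, p)) :
  open U -> smooth_mx U F -> smooth_mx U (fun x => F x *m a).
Proof.
move=> oU sF i j k.
have -> : (fun x => (F x *m a) i j) = fun x => \sum_l F x i l * a l j.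
  by apply/funext => x; rewrite mxE.
elim: (index_enum _) => [|l r IH].
  rewrite (_ : (fun x => _) = fun=> 0); first exact: smooth_cst.
  by apply/funext => x; rewrite big_nil.
rewrite (_ : (fun x => _) =
    fun x => a l j * F x i l + \sum_(l <- r) F x i l * a l j).
  by apply: Ck_lin => //; exact: sF.
by apply/funext => x; rewrite big_cons mulrC.
Qed.

Lemma smooth_mxN U m n (F : 'cV[R]_d -> 'M[R]_(m, n)) :
  open U -> smooth_mx U F -> smooth_mx U (fun x => - F x).
Proof.
move=> oU sF i j k; apply: (@Ck_eq _ _ (fun x => -1 * F x i j + 0)) => //.
  by move=> x _; rewrite mulN1r addr0 mxE.
by apply: Ck_lin => //; [exact: sF | exact: smooth_cst].
Qed.

Lemma smooth_mxdiff U m n (F : 'cV[R]_d -> 'M[R]_(m, n)) x :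
  smooth_mx U F -> U x -> mxdiff F x.
Proof. by move=> sF Ux i j; have [dF _] := sF i j 1%N; exact: dF. Qed.

End Smooth.

Section MatrixDifferentiability.
Context {R : realType} {d : nat}.
Implicit Types (x : 'cV[R]_d).

Lemma differentiable_bigsum (I : Type) (r : seq I) (f : I -> 'cV[R]_d -> R) x :
  (forall i, differentiable (f i) x) ->
  differentiable (fun y => \sum_(i <- r) f i y) x.
Proof.
move=> df; elim: r => [|i r IH].
  rewrite (_ : (fun y => _) = fun=> 0); last by apply/funext => y; rewrite big_nil.
  exact: differentiable_cst.
rewrite (_ : (fun y => _) = f i + (fun y => \sum_(i <- r) f i y)).
  exact: differentiableD.
by apply/funext => y; rewrite big_cons.
Qed.

Lemma differentiable_mulc a (f : 'cV[R]_d -> R) x :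
  differentiable f x -> differentiable (fun y => a * f y) x.
Proof. by move=> df; exact: (@differentiableZ _ _ _ f a x df). Qed.

Lemma differentiable_bigprod (I : Type) (r : seq I) (f : I -> 'cV[R]_d -> R) x :
  (forall i, differentiable (f i) x) ->
  differentiable (fun y => \prod_(i <- r) f i y) x.
Proof.
move=> df; elim: r => [|i r IH].
  rewrite (_ : (fun y => _) = fun=> 1); last by apply/funext => y; rewrite big_nil.
  exact: differentiable_cst.
rewrite (_ : (fun y => _) = f i * (fun y => \prod_(i <- r) f i y)).
  exact: differentiableM.
by apply/funext => y; rewrite big_cons.
Qed.

Lemma differentiable_det n (F : 'cV[R]_d -> 'M[R]_n) x : mxdiff F x ->
  differentiable (fun y => \det (F y)) x.
Proof.
move=> dF; apply: differentiable_bigsum => s.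
apply: differentiable_mulc.
by apply: differentiable_bigprod => i; exact: dF.
Qed.

(** Cramer's rule. *)
Lemma mxdiff_invmx n (F : 'cV[R]_d -> 'M[R]_n) (U : set 'cV[R]_d) x :
  open U -> U x -> (forall y, U y -> F y \in unitmx) -> mxdiff F x ->
  mxdiff (fun y => invmx (F y)) x.
Proof.
move=> oU Ux uF dF.
apply: (@mxdiff_near _ _ _ _ (fun y => (\det (F y))^-1 *: \adj (F y))).
  by apply: (near_open oU Ux) => y Uy; rewrite /invmx uF.
move=> i j.
rewrite (_ : (fun y => _) =
    (fun y => (\det (F y))^-1) * (fun y => cofactor (F y) j i)); last first.
  by apply/funext => y; rewrite !mxE.
have dd := differentiable_det dF.
apply: differentiableM; first apply: (differentiableV dd).
  by have := uF x Ux; rewrite unitmxE unitfE.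
apply: differentiable_mulc.
apply: differentiable_det => k l.
rewrite (_ : (fun y => _) = fun y => F y (lift j k) (lift i l)) //.
by apply/funext => y; rewrite !mxE.
Qed.

Lemma mxdiff_col_mx m1 m2 n (A : 'cV[R]_d -> 'M[R]_(m1, n))
    (B : 'cV[R]_d -> 'M[R]_(m2, n)) x :
  mxdiff A x -> mxdiff B x -> mxdiff (fun y => col_mx (A y) (B y)) x.
Proof.
move=> dA dB i j; case: (split_ordP i) => k ->.
  rewrite (_ : (fun y => _) = fun y => A y k j) //.
  by apply/funext => y; rewrite col_mxEu.
rewrite (_ : (fun y => _) = fun y => B y k j) //.
by apply/funext => y; rewrite col_mxEd.
Qed.

Lemma mxdiff_row_mx m n1 n2 (A : 'cV[R]_d -> 'M[R]_(m, n1))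
    (B : 'cV[R]_d -> 'M[R]_(m, n2)) x :
  mxdiff A x -> mxdiff B x -> mxdiff (fun y => row_mx (A y) (B y)) x.
Proof.
move=> dA dB i j; case: (split_ordP j) => k ->.
  rewrite (_ : (fun y => _) = fun y => A y i k) //.
  by apply/funext => y; rewrite row_mxEl.
rewrite (_ : (fun y => _) = fun y => B y i k) //.
by apply/funext => y; rewrite row_mxEr.
Qed.

Lemma mxdiff_block m1 m2 n1 n2 (A : 'cV[R]_d -> 'M[R]_(m1, n1))
    (B : 'cV[R]_d -> 'M[R]_(m1, n2)) (C : 'cV[R]_d -> 'M[R]_(m2, n1))
    (D : 'cV[R]_d -> 'M[R]_(m2, n2)) x :
  mxdiff A x -> mxdiff B x -> mxdiff C x -> mxdiff D x ->
  mxdiff (fun y => block_mx (A y) (B y) (C y) (D y)) x.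
Proof. by move=> *; apply: mxdiff_col_mx; apply: mxdiff_row_mx. Qed.

End MatrixDifferentiability.

(** * The pairing and the Courant bracket *)

Section Pairing.
Context {R : realType} {d : nat}.
Implicit Types (s t r : 'cV[R]_(d + d)) (xi X : 'cV[R]_d) (a : R).

Lemma dotvE xi X : dotv xi X = \sum_i xi i 0 * X i 0.
Proof. by rewrite /dotv mxE; apply: eq_bigr => i _; rewrite mxE. Qed.

Lemma dotvC xi X : dotv xi X = dotv X xi.
Proof. by rewrite !dotvE; apply: eq_bigr => i _; rewrite mulrC. Qed.

Lemma dotvDl xi eta X : dotv (xi + eta) X = dotv xi X + dotv eta X.
Proof. by rewrite /dotv linearD mulmxDl mxE. Qed.

Lemma dotvZl a xi X : dotv (a *: xi) X = a * dotv xi X.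
Proof. by rewrite /dotv linearZ /= -scalemxAl mxE. Qed.

Lemma dotvNl xi X : dotv (- xi) X = - dotv xi X.
Proof. by rewrite -scaleN1r dotvZl mulN1r. Qed.

Lemma dotvDr xi X Y : dotv xi (X + Y) = dotv xi X + dotv xi Y.
Proof. by rewrite !(dotvC xi) dotvDl. Qed.

Lemma dotvZr a xi X : dotv xi (a *: X) = a * dotv xi X.
Proof. by rewrite !(dotvC xi) dotvZl. Qed.

Lemma dotvNr xi X : dotv xi (- X) = - dotv xi X.
Proof. by rewrite !(dotvC xi) dotvNl. Qed.

Lemma dotv0r xi : dotv xi 0 = 0.
Proof. by rewrite /dotv mulmx0 mxE. Qed.

Lemma dotv_mul (B : 'M[R]_d) xi X : dotv (B^T *m xi) X = dotv xi (B *m X).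
Proof. by rewrite /dotv trmx_mul trmxK mulmxA. Qed.

Lemma dotv_basis xi (k : 'I_d) : dotv xi (basis_vec k) = xi k 0.
Proof.
rewrite dotvE (bigD1 k) //= !mxE !eqxx mulr1 big1 ?addr0 // => i ik.
by rewrite mxE (negPf ik) mulr0.
Qed.

Lemma pairingC s t : pairing s t = pairing t s.
Proof. by rewrite /pairing addrC. Qed.

Lemma pairingDl s t r : pairing (s + t) r = pairing s r + pairing t r.
Proof. by rewrite /pairing !linearD /= dotvDl dotvDr; ring. Qed.

Lemma pairingZl a s r : pairing (a *: s) r = a * pairing s r.
Proof. by rewrite /pairing !linearZ /= dotvZl dotvZr; ring. Qed.

Lemma pairingNl s r : pairing (- s) r = - pairing s r.
Proof. by rewrite -scaleN1r pairingZl mulN1r. Qed.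

Lemma pairingDr s t r : pairing r (s + t) = pairing r s + pairing r t.
Proof. by rewrite !(pairingC r) pairingDl. Qed.

Lemma pairingZr a s r : pairing r (a *: s) = a * pairing r s.
Proof. by rewrite !(pairingC r) pairingZl. Qed.

Lemma pairingNr s r : pairing r (- s) = - pairing r s.
Proof. by rewrite !(pairingC r) pairingNl. Qed.

Lemma pairing0l s : pairing 0 s = 0.
Proof. by rewrite -(scale0r 0) pairingZl mul0r. Qed.

Lemma pairing_col (X xi Y eta : 'cV[R]_d) :
  pairing (col_mx X xi) (col_mx Y eta) = 2^-1 * (dotv xi Y + dotv eta X).
Proof. by rewrite /pairing !col_mxKu !col_mxKd. Qed.

Lemma pairing_eq0 s : (forall t, pairing s t = 0) -> s = 0.
Proof.
move=> s0; have half : 2^-1 != 0 :> R by rewrite invr_eq0 pnatr_eq0.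
rewrite -[s]vsubmxK; suff -> : usubmx s = 0.
  suff -> : dsubmx s = 0 by rewrite col_mx0.
  apply/matrixP => k j; rewrite !ord1 [RHS]mxE -dotv_basis.
  have := s0 (col_mx (basis_vec k) 0).
  rewrite /pairing col_mxKu col_mxKd (dotvC 0) dotv0r addr0.
  by move/eqP; rewrite mulf_eq0 (negPf half) => /eqP.
apply/matrixP => k j; rewrite !ord1 [RHS]mxE -dotv_basis.
have := s0 (col_mx 0 (basis_vec k)).
rewrite /pairing col_mxKu col_mxKd dotv0r add0r dotvC.
by move/eqP; rewrite mulf_eq0 (negPf half) => /eqP.
Qed.

Lemma pairing_inj s t :
  (forall r, pairing s r = pairing t r) -> s = t.
Proof.
move=> st; apply/eqP; rewrite -subr_eq0; apply/eqP/pairing_eq0 => r.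
by rewrite pairingDl pairingNl st subrr.
Qed.

End Pairing.

Definition pairingE := (@pairingDl, @pairingDr, @pairingNl, @pairingNr,
  @pairingZl, @pairingZr).

Section SectionCalculus.
Context {R : realType} {d : nat}.
Implicit Types (x v : 'cV[R]_d) (s : tsec R d).

Lemma ddir_usubmx s x v :
  ddir v (fun y => usubmx (s y)) x = usubmx (ddir v s x).
Proof.
apply/matrixP => i j; rewrite !mxE; congr ('D_v _ x).
by apply/funext => y; rewrite mxE.
Qed.

Lemma ddir_dsubmx s x v :
  ddir v (fun y => dsubmx (s y)) x = dsubmx (ddir v s x).
Proof.
apply/matrixP => i j; rewrite !mxE; congr ('D_v _ x).
by apply/funext => y; rewrite mxE.
Qed.

Lemma mxdiff_usubmx s x : mxdiff s x -> mxdiff (fun y => usubmx (s y)) x.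
Proof.
move=> ds i j; have -> : (fun y => usubmx (s y) i j) = (fun y => s y (lshift d i) j).
  by apply/funext => y; rewrite mxE.
exact: ds.
Qed.

Lemma mxdiff_dsubmx s x : mxdiff s x -> mxdiff (fun y => dsubmx (s y)) x.
Proof.
move=> ds i j; have -> : (fun y => dsubmx (s y) i j) = (fun y => s y (rshift d i) j).
  by apply/funext => y; rewrite mxE.
exact: ds.
Qed.

Lemma mxdiff_tr m n (F : 'cV[R]_d -> 'M[R]_(m, n)) x :
  mxdiff F x -> mxdiff (fun y => (F y)^T) x.
Proof.
move=> dF i j; have -> : (fun y => (F y)^T i j) = (fun y => F y j i).
  by apply/funext => y; rewrite mxE.
exact: dF.
Qed.

Lemma ddir_tr m n (F : 'cV[R]_d -> 'M[R]_(m, n)) x v :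
  ddir v (fun y => (F y)^T) x = (ddir v F x)^T.
Proof.
apply/matrixP => i j; rewrite !mxE; congr ('D_v _ x).
by apply/funext => y; rewrite mxE.
Qed.

Lemma vec_basis v : v = \sum_k v k 0 *: basis_vec k.
Proof.
apply/matrixP => i j; rewrite ord1 summxE (bigD1 i) //= !mxE !eqxx mulr1.
by rewrite big1 ?addr0 // => k ki; rewrite !mxE eq_sym (negPf ki) mulr0.
Qed.

Lemma derive_basis (f : 'cV[R]_d -> R) x v : differentiable f x ->
  'D_v f x = \sum_k v k 0 * 'D_(basis_vec k) f x.
Proof.
move=> df; rewrite {1}(vec_basis v) deriveE // linear_sum.
by apply: eq_bigr => k _; rewrite linearZ /= deriveE.
Qed.

Lemma jac_mul m (F : 'cV[R]_d -> 'cV[R]_m) x v : mxdiff F x ->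
  jac F x *m v = ddir v F x.
Proof.
move=> dF; apply/matrixP => i j; rewrite !ord1 !mxE derive_basis //.
by apply: eq_bigr => k _; rewrite !mxE mulrC.
Qed.

Lemma dotv_grad (f : 'cV[R]_d -> R) x v : differentiable f x ->
  dotv (grad f x) v = 'D_v f x.
Proof.
move=> df; rewrite dotvE derive_basis //.
by apply: eq_bigr => k _; rewrite !mxE mulrC.
Qed.

Lemma mxdiff_dotv (xi X : 'cV[R]_d -> 'cV[R]_d) x : mxdiff xi x -> mxdiff X x ->
  differentiable (fun y => dotv (xi y) (X y)) x.
Proof. by move=> dxi dX; apply: mxdiff_mul => //; exact: mxdiff_tr. Qed.

Lemma derive_dotv (xi X : 'cV[R]_d -> 'cV[R]_d) x v : mxdiff xi x -> mxdiff X x ->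
  'D_v (fun y => dotv (xi y) (X y)) x
  = dotv (ddir v xi x) (X x) + dotv (xi x) (ddir v X x).
Proof.
move=> dxi dX.
have := ddir_mul v (mxdiff_tr dxi) dX => /matrixP /(_ 0 0).
by rewrite ddir_tr !mxE /dotv => ->; rewrite !mxE.
Qed.

End SectionCalculus.

(* The pairings are abstracted up to conversion: their occurrences may differ
   in the inferred algebraic structures, which [ring] would not identify. *)
Ltac gen_pairings := repeat match goal with
  | |- context [pairing ?a ?b] => move: (pairing a b) => ?
  | |- context [dotv ?a ?b] => move: (dotv a b) => ? end.

Section Courant.
Context {R : realType} {d : nat}.
Implicit Types (x v : 'cV[R]_d) (s t : tsec R d).

(** The value at a point of the bracket of two sections, paired with [c].  Only
    the values [a], [b] of the sections and their derivatives [S], [T] along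
    tangent vectors enter: the Lie derivatives and the gradient in the
    definition of the bracket combine into derivatives for the pairing.  This
    form treats vectors and covectors alike, so that endomorphisms of
    T (+) T^* can be moved across the pairing. *)
Definition jet_bracket (w : form3 R d) (a : 'cV[R]_(d + d))
    (S : 'cV[R]_d -> 'cV[R]_(d + d)) (b : 'cV[R]_(d + d))
    (T : 'cV[R]_d -> 'cV[R]_(d + d)) (c : 'cV[R]_(d + d)) : R :=
  pairing (T (usubmx a)) c - pairing (S (usubmx b)) c
  + 2^-1 * (pairing (S (usubmx c)) b - pairing a (T (usubmx c)))
  + 2^-1 * dotv (iprod3 w (usubmx a) (usubmx b)) (usubmx c).

Lemma courant_pairing (h : 'cV[R]_d -> form3 R d) s t x c :
  mxdiff s x -> mxdiff t x ->
  pairing (courant h s t x) c =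
  jet_bracket (h x) (s x) (fun v => ddir v s x) (t x) (fun v => ddir v t x) c.
Proof.
move=> ds dt; rewrite -{1}[c]vsubmxK /courant pairing_col /lie /lieD.
have dX := mxdiff_usubmx ds; have dY := mxdiff_usubmx dt.
have dxi := mxdiff_dsubmx ds; have deta := mxdiff_dsubmx dt.
have dd := mxdiff_dotv deta dX; have dd' := mxdiff_dotv dxi dY.
rewrite !(dotvDl, dotvDr, dotvNl, dotvNr, dotvZl).
rewrite !dotv_mul !jac_mul // dotv_grad; last exact: differentiableB.
rewrite deriveB; try exact: diff_derivable.
rewrite !derive_dotv // !ddir_usubmx ?ddir_dsubmx //.
rewrite /jet_bracket /pairing.
by repeat match goal with |- context [dotv ?a ?b] =>
  generalize (dotv a b); intro end; field.
Qed.

End Courant.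

Section JetAlgebra.
Context {R : realType} {d : nat} (w : form3 R d).
Hypothesis wP : alt_trilinear w.
Implicit Types (a b c : 'cV[R]_(d + d)) (S T : 'cV[R]_d -> 'cV[R]_(d + d)).

Lemma jet_bracket_antisym a S b T c :
  jet_bracket w a S b T c = - jet_bracket w b T a S c.
Proof.
case: wP => _ skew _; rewrite /jet_bracket.
have -> : iprod3 w (usubmx a) (usubmx b) = - iprod3 w (usubmx b) (usubmx a).
  by apply/matrixP => i j; rewrite !mxE skew.
by rewrite dotvNl (pairingC a (T _)) (pairingC b (S _)); gen_pairings; ring.
Qed.

Lemma jet_bracket_linl k a S a' S' b T c :
  T (usubmx (k *: a + a')) = k *: T (usubmx a) + T (usubmx a') ->
  jet_bracket w (k *: a + a') (fun v => k *: S v + S' v) b T c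
  = k * jet_bracket w a S b T c + jet_bracket w a' S' b T c.
Proof.
case: wP => lin _ _ eT; rewrite /jet_bracket eT.
have -> : iprod3 w (usubmx (k *: a + a')) (usubmx b)
    = k *: iprod3 w (usubmx a) (usubmx b) + iprod3 w (usubmx a') (usubmx b).
  by apply/matrixP => i j; rewrite !mxE linearP /= lin.
by rewrite !pairingE !dotvDl !dotvZl; gen_pairings; ring.
Qed.

End JetAlgebra.

Section BracketAlgebra.
Context {R : realType} {d : nat} (h : 'cV[R]_d -> form3 R d) (x : 'cV[R]_d).
Hypothesis hx : alt_trilinear (h x).
Implicit Types (s t : tsec R d).

(** The pairing is nondegenerate, so identities between brackets may be tested
    on the jets of the sections. *)
Lemma courant_near s s' t t' : (\near x, s x = s' x) -> (\near x, t x = t' x) ->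
  mxdiff s x -> mxdiff t x -> courant h s t x = courant h s' t' x.
Proof.
move=> ss' tt' ds dt; apply: pairing_inj => c.
rewrite !courant_pairing //; try by [exact: mxdiff_near ss' ds | exact: mxdiff_near tt' dt].
rewrite /jet_bracket (nbhs_singleton ss') (nbhs_singleton tt').
by rewrite !(ddir_near _ ss') !(ddir_near _ tt').
Qed.

Lemma courant_antisym s t : mxdiff s x -> mxdiff t x ->
  courant h s t x = - courant h t s x.
Proof.
move=> ds dt; apply: pairing_inj => c.
by rewrite pairingNl !courant_pairing // jet_bracket_antisym.
Qed.

Lemma courant_linl a s s' t : mxdiff s x -> mxdiff s' x -> mxdiff t x ->
  courant h (fun y => a *: s y + s' y) t x
  = a *: courant h s t x + courant h s' t x.
Proof.
move=> ds ds' dt; apply: pairing_inj => c.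
rewrite pairingDl pairingZl !courant_pairing //; last exact: mxdiff_lin.
have -> : (fun v => ddir v (fun y => a *: s y + s' y) x)
    = fun v => a *: ddir v s x + ddir v s' x.
  by apply/funext => v; exact: ddir_linr.
apply: (@jet_bracket_linl _ _ _ hx a (s x) _ (s' x) _ (t x) (fun v => ddir v t x) c).
by rewrite linearP; exact: ddir_lin.
Qed.

Lemma courant_linr a s t t' : mxdiff s x -> mxdiff t x -> mxdiff t' x ->
  courant h s (fun y => a *: t y + t' y) x
  = a *: courant h s t x + courant h s t' x.
Proof.
move=> ds dt dt'; rewrite !(courant_antisym ds) //; last exact: mxdiff_lin.
by rewrite courant_linl // opprD scalerN.
Qed.

Lemma courantNl s t : mxdiff s x -> mxdiff t x ->
  courant h (fun y => - s y) t x = - courant h s t x.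
Proof.
have opp m n (B : 'M[R]_(m, n)) : - B = - 2 *: B + B.
  by rewrite scaleNr scaler_nat mulr2n opprD subrK.
move=> ds dt; rewrite (opp _ _ (courant h s t x)) -courant_linl //.
by congr (courant h _ t x); apply/funext => y; exact: opp.
Qed.

Lemma courantNr s t : mxdiff s x -> mxdiff t x ->
  courant h s (fun y => - t y) x = - courant h s t x.
Proof.
move=> ds dt; rewrite !(courant_antisym ds) //; last exact: mxdiffN.
by rewrite courantNl.
Qed.

End BracketAlgebra.

(** * The Nijenhuis tensor and involutivity *)

Section Nijenhuis.
Context {R : realType} {d : nat}.

Definition hpair (w : form3 R d) (a b c : 'cV[R]_(d + d)) : R :=
  2^-1 * dotv (iprod3 w (usubmx a) (usubmx b)) (usubmx c).

(** The pairing of [N(a, b)] with [c] when the derivative of the structure along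
    [v] is [A v]: it is the part of the brackets in [N] where [J] itself is
    differentiated, together with the contribution of the 3-form. *)
Definition nijenhuis (w : form3 R d) (J : 'M[R]_(d + d))
    (A : 'cV[R]_d -> 'M[R]_(d + d)) (a b c : 'cV[R]_(d + d)) : R :=
  pairing (A (usubmx (J *m a)) *m b) (J *m c)
  - pairing (A (usubmx (J *m b)) *m a) (J *m c)
  + 2^-1 * (pairing (A (usubmx (J *m c)) *m a) (J *m b)
            - pairing (J *m a) (A (usubmx (J *m c)) *m b))
  - (pairing (A (usubmx a) *m b) c - pairing (A (usubmx b) *m a) c
     + 2^-1 * (pairing (A (usubmx c) *m a) b - pairing a (A (usubmx c) *m b)))
  + (hpair w (J *m a) (J *m b) (J *m c) - hpair w a b (J *m c)
     - hpair w a (J *m b) c - hpair w (J *m a) b c).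

(** Tensoriality.  The derivative [S] of the first section enters the four
    brackets through [S' = A a + J S]; since [J] is orthogonal for the pairing
    and [J^2 = -1], its contributions cancel in pairs, and so do those of [T]. *)
Lemma nijenhuis_jet (w : form3 R d) (J : 'M[R]_(d + d))
    (A : 'cV[R]_d -> 'M[R]_(d + d)) (S T : 'cV[R]_d -> 'cV[R]_(d + d))
    (a b c : 'cV[R]_(d + d)) :
  J *m J = - 1%:M ->
  (forall a b, pairing (J *m a) b = - pairing a (J *m b)) ->
  let S' := fun v => A v *m a + J *m S v in
  let T' := fun v => A v *m b + J *m T v in
  jet_bracket w (J *m a) S' (J *m b) T' (J *m c)
  - jet_bracket w a S b T (J *m c)
  - jet_bracket w a S (J *m b) T' c - jet_bracket w (J *m a) S' b T c
  = nijenhuis w J A a b c.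
Proof.
move=> JJ Jskew S' T'.
have iso u v : pairing (J *m u) (J *m v) = pairing u v.
  by rewrite Jskew mulmxA JJ mulNmx mul1mx pairingNr opprK.
have eT1 v r : pairing (T' v) r = pairing (A v *m b) r - pairing (T v) (J *m r).
  by rewrite /T' pairingDl Jskew.
have eS1 v r : pairing (S' v) r = pairing (A v *m a) r - pairing (S v) (J *m r).
  by rewrite /S' pairingDl Jskew.
have JJv u : J *m (J *m u) = - u by rewrite mulmxA JJ mulNmx mul1mx.
rewrite /jet_bracket /nijenhuis -![2^-1 * dotv _ _]/(hpair _ _ _ _).
rewrite !(pairingC _ (T' _)) !eT1 !eS1 !JJv !pairingNr.
rewrite !(pairingC (J *m a) (A _ *m b)) !(pairingC a (A _ *m b)).
rewrite !(pairingC (J *m a) (T _)) !(pairingC a (T _)).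
gen_pairings.
do 4![move: (hpair _ _ _ _) => ?].
by field.
Qed.

Lemma nijenhuis_bracket (h : 'cV[R]_d -> form3 R d) (J : 'cV[R]_d -> 'M[R]_(d + d))
    (x : 'cV[R]_d) (s t : tsec R d) (c : 'cV[R]_(d + d)) :
  J x *m J x = - 1%:M ->
  (forall a b, pairing (J x *m a) b = - pairing a (J x *m b)) ->
  mxdiff J x -> mxdiff s x -> mxdiff t x ->
  let Js := fun y => J y *m s y in let Jt := fun y => J y *m t y in
  pairing (J x *m (courant h s t x - courant h Js Jt x)
           - courant h s Jt x - courant h Js t x) c
  = nijenhuis (h x) (J x) (fun v => ddir v J x) (s x) (t x) c.
Proof.
move=> JJ Jskew dJ ds dt Js Jt.
have dJs : mxdiff Js x by exact: mxdiff_mul.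
have dJt : mxdiff Jt x by exact: mxdiff_mul.
rewrite mulmxBr !(pairingDl, pairingNl) !Jskew !courant_pairing //.
rewrite -(nijenhuis_jet _ _ (fun v => ddir v s x) (fun v => ddir v t x)) //.
rewrite opprK [- _ + _]addrC.
have eJ (r : tsec R d) : mxdiff r x -> (fun v => ddir v (fun y => J y *m r y) x) =
    (fun v => ddir v J x *m r x + J x *m ddir v r x).
  by move=> dr; apply/funext => v; rewrite ddir_mul.
by rewrite -!eJ.
Qed.

End Nijenhuis.

Section Involutivity.
Context {R : realType} {d : nat}.
Implicit Types (x : 'cV[R]_d) (s t : tsec R d) (U : set 'cV[R]_d).

Definition orthogonal_complex (J : 'M[R]_(d + d)) : Prop :=
  J *m J = - 1%:M /\ forall a b, pairing (J *m a) b = - pairing a (J *m b).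

Definition act (J : 'cV[R]_d -> 'M[R]_(d + d)) s : tsec R d :=
  fun x => J x *m s x.

Definition nijenhuis_vec (h : 'cV[R]_d -> form3 R d) J s t x : 'cV[R]_(d + d) :=
  J x *m (courant h s t x - courant h (act J s) (act J t) x)
  - courant h s (act J t) x - courant h (act J s) t x.

Definition nijenhuis_at (h : 'cV[R]_d -> form3 R d) J x :=
  nijenhuis (h x) (J x) (fun v => ddir v J x).

Lemma nijenhuis_vec_eq0 h J x s t : orthogonal_complex (J x) ->
  mxdiff J x -> mxdiff s x -> mxdiff t x ->
  (forall a b c, nijenhuis_at h J x a b c = 0) -> nijenhuis_vec h J s t x = 0.
Proof.
move=> [JJ Jskew] dJ ds dt N0; apply: pairing_eq0 => c.
rewrite -(N0 (s x) (t x) c); exact: nijenhuis_bracket.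
Qed.

(** The test sections are [a - i J a] with [a] constant; the real part of the
    condition on their bracket is [N(a, b) = 0]. *)
Lemma involutive_nijenhuis U h J x :
  open U -> U x -> alt_trilinear (h x) -> smooth_mx U J ->
  (forall y, U y -> orthogonal_complex (J y)) ->
  (forall s t : ctsec R d, csmooth U s -> csmooth U t ->
    in_ieigen J U s -> in_ieigen J U t -> in_ieigen J U (ccourant h s t)) ->
  forall a b c, nijenhuis_at h J x a b c = 0.
Proof.
move=> oU Ux hx sJ oJ inv a b c.
pose sec u : ctsec R d := ((fun=> u), (fun y => - (J y *m u))).
have csec u : csmooth U (sec u).
  split=> /=; first by move=> i j; exact: smooth_cst.
  by apply: smooth_mxN => //; exact: smooth_mulmx_cst.
have esec u : in_ieigen J U (sec u).
  move=> y Uy; rewrite /= opprK mulmxN mulmxA (oJ y Uy).1 mulNmx opprK mul1mx.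
  by split.
have dJ := smooth_mxdiff sJ Ux.
have dJu u : mxdiff (act J (fun=> u)) x by apply: mxdiff_mul => //; exact: mxdiff_cst.
have [e _] := inv _ _ (csec a) (csec b) (esec a) (esec b) x Ux.
move: e; rewrite /= !courantNl ?courantNr //;
  do ?[exact: mxdiff_cst | exact: dJu | exact: mxdiffN (dJu _)].
rewrite opprK => e; have [JJ Jskew] := oJ x Ux.
rewrite /nijenhuis_at -(nijenhuis_bracket h (s := fun=> a) (t := fun=> b)) //;
  do ?exact: mxdiff_cst.
rewrite -/(act J (fun=> a)) -/(act J (fun=> b)) e opprD !opprK.
by rewrite -addrA -opprD subrr pairing0l.
Qed.

(** An arbitrary section of the eigenbundle is [s - i J s] with [s] its real
    part, so the bracket of two of them is in the eigenbundle when
    [N(s, t) = 0], even if [s] and [t] are not constant. *)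
Lemma nijenhuis_involutive U h J :
  open U -> (forall x, U x -> alt_trilinear (h x)) ->
  (forall x, U x -> mxdiff J x) ->
  (forall x, U x -> orthogonal_complex (J x)) ->
  (forall x, U x -> forall a b c, nijenhuis_at h J x a b c = 0) ->
  forall s t : ctsec R d, csmooth U s -> csmooth U t ->
    in_ieigen J U s -> in_ieigen J U t -> in_ieigen J U (ccourant h s t).
Proof.
move=> oU hU dJ oJ N0 [s s'] [t t'] [/= cs cs'] [/= ct ct'] es et x Ux /=.
have [JJ Jskew] := oJ x Ux.
have ds := smooth_mxdiff cs Ux; have dt := smooth_mxdiff ct Ux.
have dJs : mxdiff (act J s) x by apply: mxdiff_mul (dJ x Ux) ds.
have dJt : mxdiff (act J t) x by apply: mxdiff_mul (dJ x Ux) dt.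
have ns : \near x, s' x = - act J s x.
  by apply: (near_open oU) => // y Uy; rewrite /act (es y Uy).1 opprK.
have nt : \near x, t' x = - act J t x.
  by apply: (near_open oU) => // y Uy; rewrite /act (et y Uy).1 opprK.
have triv (r : tsec R d) : \near x, r x = r x by apply: (near_open oU Ux).
have ds' := smooth_mxdiff cs' Ux; have dt' := smooth_mxdiff ct' Ux.
rewrite (courant_near h ns nt ds' dt') (courant_near h ns (triv t) ds' dt).
rewrite (courant_near h (triv s) nt ds dt').
rewrite !courantNl ?courantNr //; do ?by [exact: mxdiffN | exact: hU].
rewrite opprK.
have := nijenhuis_vec_eq0 (oJ x Ux) (dJ x Ux) ds dt (N0 x Ux).
rewrite /nijenhuis_vec.
set P := courant h s t x; set Q := courant h (act J s) _ x.
set S := courant h s _ x; set T := courant h (act J s) _ x => e.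
have e1 : J x *m (P - Q) = S + T by apply/eqP; rewrite -subr_eq0 opprD addrA e.
split; first by rewrite e1 opprD !opprK.
by rewrite -opprD mulmxN -e1 mulmxA JJ mulNmx mul1mx opprK.
Qed.

End Involutivity.

(** * Integrability of the whole sphere of structures *)

Ltac vector_ring :=
  repeat match goal with |- context [?A *m ?b] => move: (A *m b) => ? end;
  apply/matrixP => ? ?; rewrite !mxE; ring.

(** In [nijenhuis_mixed], [i], [j], [p] are the sums [[Is, t] + [s, It]] for
    [I], [J], [K], and [q], [k], [l] are the mixed sums [[Is, Jt] + [Js, It]],
    [[Ks, It] + [Is, Kt]], [[Js, Kt] + [Ks, Jt]].  The first two equations
    determine [k] and [l]; put into the third, they cancel [p] and leave [q]. *)
Lemma quaternion_elim (R : realType) m (I J K : 'M[R]_m)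
    (i j p q k l : 'cV[R]_m) :
  I *m I = - 1%:M -> J *m J = - 1%:M -> K *m I = J -> J *m K = I ->
  I *m (j - k) - q - p = 0 -> J *m (i + l) - q + p = 0 ->
  K *m (j + k) + i - l = 0 -> q = I *m j + J *m i.
Proof.
move=> II JJ KI JK e1 e2 e3.
have ek : k = j + I *m (q + p).
  have : I *m (I *m (j - k)) = I *m (q + p).
    by congr (_ *m _); apply/eqP; rewrite -subr_eq0 opprD addrA e1.
  rewrite mulmxA II mulNmx mul1mx opprB => <-.
  by rewrite addrC subrK.
have el : l = - i - J *m (q - p).
  have : J *m (J *m (i + l)) = J *m (q - p).
    by congr (_ *m _); apply/eqP; rewrite -subr_eq0 opprB addrCA addrC e2.
  rewrite mulmxA JJ mulNmx mul1mx => <-.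
  by rewrite opprK addKr.
move: e3; rewrite ek el !(opprD, opprK, mulmxDr, mulmxN) mulmxA KI mulmxA KI => e3.
have e4 : 2 *: (K *m j + J *m q + i) = 0.
  rewrite -[RHS]e3 scaler_nat mulr2n.
  set a := K *m j; set b := J *m q; set c := J *m p.
  by apply/matrixP => r s; rewrite !mxE; ring.
have e5 : K *m j + J *m q + i = 0.
  by apply/eqP; move/eqP: e4; rewrite scaler_eq0 pnatr_eq0.
have : J *m (K *m j + J *m q + i) = 0 by rewrite e5 mulmx0.
rewrite !mulmxDr !mulmxA JK JJ mulNmx mul1mx => e6.
by apply/eqP; rewrite eq_sym -subr_eq0 addrAC e6.
Qed.

Section Hypercomplex.
Context {R : realType} {d : nat} (h : 'cV[R]_d -> form3 R d).
Implicit Types (x : 'cV[R]_d) (s t : tsec R d) (U : set 'cV[R]_d).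
Implicit Types (I J K : 'cV[R]_d -> 'M[R]_(d + d)).

(** [a s] is written as [(a - 1) s + s], to which linearity applies. *)
Lemma courantZl a s t x : alt_trilinear (h x) -> mxdiff s x -> mxdiff t x ->
  courant h (fun y => a *: s y) t x = a *: courant h s t x.
Proof.
have eq1 m n (B : 'M[R]_(m, n)) : a *: B = (a - 1) *: B + B.
  by rewrite scalerBl scale1r subrK.
move=> hx ds dt; rewrite (eq1 _ _ (courant h s t x)) -courant_linl //.
by congr (courant h _ t x); apply/funext => y; exact: eq1.
Qed.

Lemma courantZr a s t x : alt_trilinear (h x) -> mxdiff s x -> mxdiff t x ->
  courant h s (fun y => a *: t y) x = a *: courant h s t x.
Proof.
have eq1 m n (B : 'M[R]_(m, n)) : a *: B = (a - 1) *: B + B.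
  by rewrite scalerBl scale1r subrK.
move=> hx ds dt; rewrite (eq1 _ _ (courant h s t x)) -courant_linr //.
by congr (courant h s _ x); apply/funext => y; exact: eq1.
Qed.

Definition quaternionic I J K x : Prop :=
  [/\ orthogonal_complex (I x), orthogonal_complex (J x), orthogonal_complex (K x),
      I x *m J x = K x & J x *m I x = - K x].

Lemma quaternionic_rot I J K x : quaternionic I J K x -> quaternionic J K I x.
Proof.
case=> oI oJ oK IJ JI; split=> //.
  by rewrite -[K x]opprK -JI mulmxN mulmxA oJ.1 mulNmx mul1mx opprK.
by rewrite -IJ -mulmxA oJ.1 mulmxN mulmx1.
Qed.

(** The polarization of [u |-> N_u] vanishes on the pair [I], [J].  The six
    equations express that [N_I] vanishes on [(Js, t)] and [(s, Jt)], [N_J] on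
    [(Is, t)] and [(s, It)], and [N_K] on [(s, Jt)] and [(Js, t)]; the products
    of two structures that occur there are again [I] or [K] up to sign. *)
Lemma nijenhuis_mixed U I J K x s t :
  open U -> U x -> alt_trilinear (h x) ->
  (forall y, U y -> quaternionic I J K y) ->
  mxdiff I x -> mxdiff J x -> mxdiff K x -> mxdiff s x -> mxdiff t x ->
  (forall a b c, nijenhuis_at h I x a b c = 0) ->
  (forall a b c, nijenhuis_at h J x a b c = 0) ->
  (forall a b c, nijenhuis_at h K x a b c = 0) ->
  courant h (act I s) (act J t) x + courant h (act J s) (act I t) x =
  I x *m (courant h s (act J t) x + courant h (act J s) t x)
  + J x *m (courant h s (act I t) x + courant h (act I s) t x).
Proof.
move=> oU Ux hx qU dI dJ dK ds dt NI NJ NK.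
have [oI oJ oK IJ JI] := qU x Ux.
have [_ _ _ JK KJ] := quaternionic_rot (qU x Ux).
have [_ _ _ KI IK] := quaternionic_rot (quaternionic_rot (qU x Ux)).
have dact F r : mxdiff F x -> mxdiff r x -> mxdiff (act F r) x by exact: mxdiff_mul.
have actIJ r : \near x, act I (act J r) x = act K r x.
  apply: (near_open oU Ux) => y Uy; rewrite /act mulmxA.
  by case: (qU y Uy) => _ _ _ ->.
have actJI r : \near x, act J (act I r) x = - act K r x.
  apply: (near_open oU Ux) => y Uy; rewrite /act mulmxA.
  by case: (qU y Uy) => _ _ _ _ ->; rewrite mulNmx.
have actKJ r : \near x, act K (act J r) x = - act I r x.
  apply: (near_open oU Ux) => y Uy; rewrite /act mulmxA.
  by case: (quaternionic_rot (qU y Uy)) => _ _ _ _ ->; rewrite mulNmx.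
have near_refl r : \near x, r x = r x :> 'cV[R]_(d + d).
  exact: (near_open oU Ux).
have near_left s1 s2 r : (\near x, s1 x = s2 x) -> mxdiff s1 x -> mxdiff r x ->
    courant h s1 r x = courant h s2 r x.
  by move=> n12 d1 dr; exact: courant_near.
have near_right s1 s2 r : (\near x, s1 x = s2 x) -> mxdiff s1 x -> mxdiff r x ->
    courant h r s1 x = courant h r s2 x.
  by move=> n12 d1 dr; exact: courant_near.
have dIs := dact _ _ dI ds; have dJs := dact _ _ dJ ds; have dKs := dact _ _ dK ds.
have dIt := dact _ _ dI dt; have dJt := dact _ _ dJ dt; have dKt := dact _ _ dK dt.
have e1 := nijenhuis_vec_eq0 oI dI dJs dt NI.
have e2 := nijenhuis_vec_eq0 oI dI ds dJt NI.
have e3 := nijenhuis_vec_eq0 oJ dJ dIs dt NJ.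
have e4 := nijenhuis_vec_eq0 oJ dJ ds dIt NJ.
have e5 := nijenhuis_vec_eq0 oK dK ds dJt NK.
have e6 := nijenhuis_vec_eq0 oK dK dJs dt NK.
have lIJ r : mxdiff r x -> courant h (act I (act J s)) r x = courant h (act K s) r x.
  by move=> dr; rewrite (near_left _ _ _ (actIJ s) (dact _ _ dI dJs) dr).
have rIJ r : mxdiff r x -> courant h r (act I (act J t)) x = courant h r (act K t) x.
  by move=> dr; rewrite (near_right _ _ _ (actIJ t) (dact _ _ dI dJt) dr).
have lJI r : mxdiff r x -> courant h (act J (act I s)) r x = - courant h (act K s) r x.
  by move=> dr; rewrite (near_left _ _ _ (actJI s) (dact _ _ dJ dIs) dr) courantNl //.
have rJI r : mxdiff r x -> courant h r (act J (act I t)) x = - courant h r (act K t) x.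
  by move=> dr; rewrite (near_right _ _ _ (actJI t) (dact _ _ dJ dIt) dr) courantNr //.
have lKJ r : mxdiff r x -> courant h (act K (act J s)) r x = - courant h (act I s) r x.
  by move=> dr; rewrite (near_left _ _ _ (actKJ s) (dact _ _ dK dJs) dr) courantNl //.
have rKJ r : mxdiff r x -> courant h r (act K (act J t)) x = - courant h r (act I t) x.
  by move=> dr; rewrite (near_right _ _ _ (actKJ t) (dact _ _ dK dJt) dr) courantNr //.
move: e1 e2 e3 e4 e5 e6; rewrite /nijenhuis_vec.
rewrite !lIJ // !rIJ // !lJI // !rJI // !lKJ // !rKJ // !mulmxBr !mulmxN !opprK.
set j1 := courant h (act J s) t x; set j2 := courant h s (act J t) x.
set i1 := courant h (act I s) t x; set i2 := courant h s (act I t) x.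
set p1 := courant h (act K s) t x; set p2 := courant h s (act K t) x.
set q1 := courant h (act I s) (act J t) x; set q2 := courant h (act J s) (act I t) x.
set k1 := courant h (act K s) (act I t) x; set k2 := courant h (act I s) (act K t) x.
set l1 := courant h (act J s) (act K t) x; set l2 := courant h (act K s) (act J t) x.
move=> e1 e2 e3 e4 e5 e6.
have e12 := congr2 +%R e1 e2; have e34 := congr2 +%R e3 e4.
have e56 := congr2 +%R e5 e6.
apply: (@quaternion_elim _ _ _ _ (K x) (i2 + i1) (j2 + j1) (p1 + p2) _ (k1 + k2) (l1 + l2)) => //.
- exact: oI.1.
- exact: oJ.1.
- rewrite -[RHS]addr0 -e12 !mulmxBr !mulmxDr; clearbody q1 q2 p1 p2; vector_ring.
- rewrite -[RHS]addr0 -e34 !mulmxDr; clearbody q1 q2 p1 p2; vector_ring.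
- rewrite -[RHS]addr0 -e56 !mulmxDr; clearbody i1 i2 l1 l2; vector_ring.
Qed.

Definition combo (I J K : 'cV[R]_d -> 'M[R]_(d + d)) (a b c : R) y : 'M[R]_(d + d) :=
  a *: I y + b *: J y + c *: K y.

Lemma combo_orthogonal_complex I J K x a b c :
  quaternionic I J K x -> a ^+ 2 + b ^+ 2 + c ^+ 2 = 1 ->
  orthogonal_complex (combo I J K a b c x).
Proof.
move=> q e; have [oI oJ oK IJ JI] := q.
have [_ _ _ JK KJ] := quaternionic_rot q.
have [_ _ _ KI IK] := quaternionic_rot (quaternionic_rot q).
split=> [|u v].
  rewrite /combo !(mulmxDl, mulmxDr) -!scalemxAl -!scalemxAr !scalerA.
  transitivity ((a ^+ 2 + b ^+ 2 + c ^+ 2) *: - 1%:M : 'M[R]_(d + d)).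
    rewrite oI.1 oJ.1 oK.1 IJ JI JK KJ KI IK; move: 1%:M => E.
    by apply/matrixP => i j; rewrite !mxE; ring.
  by rewrite e scale1r.
rewrite /combo !(mulmxDl, pairingDl, pairingDr) -!scalemxAl !pairingZl !pairingZr.
by rewrite oI.2 oJ.2 oK.2; ring.
Qed.

Lemma mxdiff_combo I J K x a b c : mxdiff I x -> mxdiff J x -> mxdiff K x ->
  mxdiff (combo I J K a b c) x.
Proof.
move=> dI dJ dK; have dZ F k : mxdiff F x -> mxdiff (fun y => k *: F y) x.
  move=> dF; have -> : (fun y => k *: F y) = (fun y => k *: F y + 0).
    by apply/funext => y; rewrite addr0.
  exact: mxdiff_lin dF (mxdiff_cst 0 x).
rewrite (_ : combo _ _ _ _ _ _ = fun y => a *: I y + (b *: J y + c *: K y)).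
  by apply: mxdiff_lin => //; apply: mxdiff_lin => //; exact: dZ.
by apply/funext => y; rewrite /combo addrA.
Qed.

(** Multiplied by [u], the tensor [N_u] becomes the quadratic expression
    [[us, ut] - u ([s, ut] + [us, t]) - [s, t]] in [(a, b, c)]: its square terms
    vanish by integrability of [I], [J], [K], and its mixed terms by
    [nijenhuis_mixed]. *)
Lemma nijenhuis_combo U I J K x a b c :
  open U -> U x -> alt_trilinear (h x) ->
  (forall y, U y -> quaternionic I J K y) ->
  mxdiff I x -> mxdiff J x -> mxdiff K x ->
  (forall u v w, nijenhuis_at h I x u v w = 0) ->
  (forall u v w, nijenhuis_at h J x u v w = 0) ->
  (forall u v w, nijenhuis_at h K x u v w = 0) ->
  a ^+ 2 + b ^+ 2 + c ^+ 2 = 1 ->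
  forall u v w, nijenhuis_at h (combo I J K a b c) x u v w = 0.
Proof.
move=> oU Ux hx qU dI dJ dK NI NJ NK e u v w.
have [oI oJ oK IJ JI] := qU x Ux.
have ou := combo_orthogonal_complex (qU x Ux) e.
have du := mxdiff_combo a b c dI dJ dK.
pose s : tsec R d := fun=> u; pose t : tsec R d := fun=> v.
have ds : mxdiff s x by exact: mxdiff_cst.
have dt : mxdiff t x by exact: mxdiff_cst.
rewrite /nijenhuis_at -(@nijenhuis_bracket _ _ h _ x s t) //; try exact ou.1; try exact ou.2.
rewrite -[X in pairing X _]/(nijenhuis_vec h (combo I J K a b c) s t x).
have q2U y : U y -> quaternionic J K I y by move=> Uy; exact/quaternionic_rot/qU.
have q3U y : U y -> quaternionic K I J y by move=> Uy; exact/quaternionic_rot/q2U.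
have mIJ := nijenhuis_mixed oU Ux hx qU dI dJ dK ds dt NI NJ NK.
have mJK := nijenhuis_mixed oU Ux hx q2U dJ dK dI ds dt NJ NK NI.
have mKI := nijenhuis_mixed oU Ux hx q3U dK dI dJ ds dt NK NI NJ.
have nI := nijenhuis_vec_eq0 oI dI ds dt NI.
have nJ := nijenhuis_vec_eq0 oJ dJ ds dt NJ.
have nK := nijenhuis_vec_eq0 oK dK ds dt NK.
suff -> : nijenhuis_vec h (combo I J K a b c) s t x = 0.
  exact: pairing0l.
have sqr F P Q S T : orthogonal_complex (F x) ->
    F x *m (P - Q) - S - T = 0 -> Q = P + F x *m (S + T) :> 'cV[R]_(d + d).
  move=> [FF _] eF; have : F x *m (F x *m (P - Q)) = F x *m (S + T).
    by congr (_ *m _); apply/eqP; rewrite -subr_eq0 opprD addrA eF.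
  by rewrite mulmxA FF mulNmx mul1mx opprB => <-; rewrite addrC subrK.
have eI := sqr _ _ _ _ _ oI nI; have eJ := sqr _ _ _ _ _ oJ nJ.
have eK := sqr _ _ _ _ _ oK nK; move: mIJ mJK mKI eI eJ eK.
have dact F r : mxdiff F x -> mxdiff r x -> mxdiff (act F r) x by exact: mxdiff_mul.
have act_combo r : act (combo I J K a b c) r =
    fun y => a *: act I r y + (b *: act J r y + c *: act K r y).
  by apply/funext => y; rewrite /act /combo !mulmxDl -!scalemxAl addrA.
have dZ F r k : mxdiff F x -> mxdiff r x -> mxdiff (fun y => k *: act F r y) x.
  move=> dF dr; rewrite (_ : (fun y => _) = fun y => k *: act F r y + 0).
    exact: mxdiff_lin (dact _ _ dF dr) (mxdiff_cst 0 x).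
  by apply/funext => y; rewrite addr0.
have dJK r : mxdiff r x -> mxdiff (fun y => b *: act J r y + c *: act K r y) x.
  by move=> dr; apply: mxdiff_lin; [exact: dact | exact: dZ].
have cl r r' : mxdiff r x -> mxdiff r' x ->
    courant h (act (combo I J K a b c) r) r' x = a *: courant h (act I r) r' x
      + (b *: courant h (act J r) r' x + c *: courant h (act K r) r' x).
  by move=> dr dr'; rewrite act_combo !courant_linl ?courantZl //;
    do ?[exact: dact | exact: dZ | exact: dJK].
have cr r r' : mxdiff r x -> mxdiff r' x ->
    courant h r (act (combo I J K a b c) r') x = a *: courant h r (act I r') x
      + (b *: courant h r (act J r') x + c *: courant h r (act K r') x).
  by move=> dr dr'; rewrite act_combo !courant_linr ?courantZr //;
    do ?[exact: dact | exact: dZ | exact: dJK].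
rewrite /nijenhuis_vec !cr ?cl //; do ?[exact: dact].
set i1 := courant h (act I s) t x; set i2 := courant h s (act I t) x.
set j1 := courant h (act J s) t x; set j2 := courant h s (act J t) x.
set k1 := courant h (act K s) t x; set k2 := courant h s (act K t) x.
set st := courant h s t x.
move: (courant h (act I s) (act I t) x) (courant h (act J s) (act J t) x)
  (courant h (act K s) (act K t) x) (courant h (act I s) (act J t) x)
  (courant h (act J s) (act I t) x) (courant h (act J s) (act K t) x)
  (courant h (act K s) (act J t) x) (courant h (act K s) (act I t) x)
  (courant h (act I s) (act K t) x) => II JJ KK IJc JIc JKc KJc KIc IKc.
move=> mIJ mJK mKI eI eJ eK.
clearbody i1 i2 j1 j2 k1 k2 st.
set S := a *: (i2 + i1) + b *: (j2 + j1) + c *: (k2 + k1).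
set Q := (X in _ *m (st - X)).
(* The coefficient of [st] below is a^2 + b^2 + c^2 = 1. *)
have eQ : Q = st + combo I J K a b c x *m S.
  have -> : Q = a ^+ 2 *: II + b ^+ 2 *: JJ + c ^+ 2 *: KK + (a * b) *: (IJc + JIc)
     + (b * c) *: (JKc + KJc) + (c * a) *: (KIc + IKc).
    by rewrite /Q; apply/matrixP => r r'; rewrite !mxE; ring.
  rewrite mIJ mJK mKI eI eJ eK /S /combo -[in RHS](scale1r st) -e.
  rewrite !(mulmxDl, mulmxDr) -!scalemxAl -!scalemxAr !mulmxDr.
  vector_ring.
have -> : st - Q = - (combo I J K a b c x *m S) by rewrite eQ opprD addrA subrr add0r.
rewrite mulmxN mulmxA ou.1 mulNmx mul1mx opprK /S.
vector_ring.
Qed.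

End Hypercomplex.

(** * Generalized metrics and the exchange of C^+ and C^- *)

Section GeneralizedMetric.
Context {R : realType} {d : nat}.
Implicit Types (G J : 'M[R]_(d + d)) (s t : 'cV[R]_(d + d)).

Definition is_gen_metric G : Prop :=
  [/\ \rank (eigenspace G^T 1) = d,
      forall s, Cplus G s -> s != 0 -> 0 < pairing s s,
      G *m G = 1%:M &
      forall s t, pairing (G *m s) t = pairing s (G *m t)].

(** [G^2 = 1] because [(G J)^2 = G^2 J^2], and [G] is self-adjoint because it is
    the quotient of two skew endomorphisms which commute. *)
Lemma kahler_involution G J : orthogonal_complex J ->
  orthogonal_complex (G *m J) -> J *m G = G *m J ->
  G *m G = 1%:M /\ forall s t, pairing (G *m s) t = pairing s (G *m t).
Proof.
move=> [JJ Jskew] [GJ GJskew] JG; split=> [|s t].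
  apply: oppr_inj; rewrite -[RHS]GJ -mulmxA [J *m (G *m J)]mulmxA JG.
  by rewrite -mulmxA JJ !mulmxN mulmx1.
have -> : s = - (J *m (J *m s)) by rewrite mulmxA JJ mulNmx mul1mx opprK.
rewrite mulmxN (mulmxA G) pairingNl GJskew opprK -JG -(mulmxA J G).
by rewrite Jskew !mulmxA JJ !(mulNmx, mul1mx) pairingNr !opprK.
Qed.

(** Covectors are null for the pairing, so the projection of [C^+] to the
    tangent space is injective by positivity; it is onto by dimension. *)
Lemma gen_metric_surj G X : is_gen_metric G ->
  exists s, Cplus G s /\ usubmx s = X.
Proof.
case=> rG pos _ _.
pose E := eigenspace G^T 1; pose B : 'M[R]_(d + d, d) := col_mx 1%:M 0.
have usub (v : 'rV[R]_(d + d)) : (v *m B)^T = usubmx v^T.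
  by rewrite -[v in LHS]hsubmxK mul_row_col mulmx1 mulmx0 addr0 trmx_lsub.
have EC (v : 'rV[R]_(d + d)) : (v <= E)%MS -> Cplus G v^T.
  move/eigenspaceP; rewrite scale1r => /(congr1 trmx).
  by rewrite trmx_mul trmxK.
have capE : (E :&: kermx B)%MS = 0.
  apply/eqP/rowV0P => v; rewrite sub_capmx => /andP [vE /sub_kermxP vB].
  apply/eqP; apply/negPn/negP => v0.
  have := pos _ (EC v vE); rewrite /pairing -usub vB trmx0 dotv0r addr0 mulr0 ltxx.
  by rewrite -(inj_eq trmx_inj) trmx0 in v0; move/(_ v0).
have := mxrank_mul_ker E B; rewrite capE mxrank0 addn0 rG => rEB.
have full : row_full (E *m B) by rewrite /row_full rEB.
have /submxP [u Xu] := submx_full X^T full.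
exists (u *m E)^T; split; first by apply: EC; exact: submxMl.
by rewrite -usub -mulmxA -Xu trmxK.
Qed.

Lemma Cplus_covector G s : is_gen_metric G -> Cplus G s -> usubmx s = 0 -> s = 0.
Proof.
case=> _ pos _ _ Cs s0; apply/eqP; apply/negPn/negP => /(pos _ Cs).
by rewrite /pairing s0 dotv0r addr0 mulr0 ltxx.
Qed.

(** A covector of [C^-] is orthogonal to [C^+], whose elements have arbitrary
    tangent parts. *)
Lemma Cminus_covector G s : is_gen_metric G -> G *m s = - s -> usubmx s = 0 -> s = 0.
Proof.
move=> mG Cs s0; rewrite -[s]vsubmxK s0; suff -> : dsubmx s = 0 by rewrite col_mx0.
apply/matrixP => k j; rewrite !ord1 [RHS]mxE -dotv_basis.
have [t [Ct tX]] := gen_metric_surj (basis_vec k) mG.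
have [_ _ _ sym] := mG.
have : pairing t s = - pairing t s by rewrite -{1}Ct sym Cs pairingNr.
move/eqP; rewrite -addr_eq0 -mulr2n mulrn_eq0 /= /pairing tX s0 dotv0r add0r.
by rewrite mulf_eq0 invr_eq0 pnatr_eq0 => /eqP.
Qed.

(** If [xi] is killed by the upper right block of [G], then [xi + G xi] is a
    covector of [C^+], hence 0; so [xi] is a covector of [C^-], hence 0. *)
Lemma gen_metric_unit G : is_gen_metric G -> ursubmx G \in unitmx.
Proof.
move=> mG; rewrite -unitmx_tr -row_free_unit; apply: inj_row_free => v v0.
apply: trmx_inj; rewrite trmx0.
have q0 : ursubmx G *m v^T = 0.
  by apply: trmx_inj; rewrite trmx_mul trmxK v0 trmx0.
have [_ _ GG _] := mG.
pose s : 'cV[R]_(d + d) := col_mx 0 v^T.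
have us : usubmx (G *m s) = 0.
  by rewrite -[G]submxK mul_block_col mulmx0 add0r q0 col_mxKu.
have e : s + G *m s = 0.
  apply: (Cplus_covector mG).
    by rewrite /Cplus /= mulmxDr (mulmxA G G) GG mul1mx addrC.
  by rewrite linearD /= us col_mxKu addr0.
have : s = 0.
  apply: (Cminus_covector mG); last by rewrite col_mxKu.
  by apply/eqP; rewrite -addr_eq0 addrC e.
by move/(congr1 dsubmx); rewrite col_mxKd linear0.
Qed.

Lemma reflC_col G (X Y : 'cV[R]_d) :
  reflC G *m col_mx X Y = col_mx X (bfield G *m X + bfield G *m X - Y).
Proof.
rewrite /reflC /expB -!mulmxA !mul_block_col.
rewrite !(mul0mx, mul1mx, mulmx0, addr0, add0r, mulNmx).
by rewrite opprD opprK addrA.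
Qed.

Lemma reflC_usub G s : is_gen_metric G ->
  usubmx (G *m (reflC G *m s)) = - usubmx (G *m s).
Proof.
move=> mG; have uG := gen_metric_unit mG.
rewrite -[s]vsubmxK; set X := usubmx s; set Y := dsubmx s.
rewrite reflC_col -{1 4}[G]submxK !mul_block_col !col_mxKu.
rewrite mulmxBr mulmxDr /bfield mulNmx mulmxN !mulmxA mulmxV // mul1mx.
set P := ulsubmx G *m X; set Q := ursubmx G *m Y.
by rewrite opprD addrA addrA subrr sub0r.
Qed.

(** An element of [C^+] or [C^-] is determined by its tangent part, which [reflC]
    preserves, so it is enough to compare tangent parts. *)
Lemma reflC_Cminus G s : is_gen_metric G -> G *m s = - s ->
  Cplus G (reflC G *m s).
Proof.
move=> mG Cs; have [_ _ GG _] := mG.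
have usr : usubmx (reflC G *m s) = usubmx s.
  by rewrite -[s in LHS]vsubmxK reflC_col col_mxKu.
rewrite /Cplus /=; apply/eqP; rewrite -subr_eq0; apply/eqP.
apply: (Cminus_covector mG).
  by rewrite mulmxBr (mulmxA G G) GG mul1mx opprB.
by rewrite linearB /= reflC_usub // Cs linearN /= opprK usr subrr.
Qed.

Lemma reflC_Cplus G s : is_gen_metric G -> Cplus G s ->
  G *m (reflC G *m s) = - (reflC G *m s).
Proof.
move=> mG Cs; have [_ _ GG _] := mG.
have usr : usubmx (reflC G *m s) = usubmx s.
  by rewrite -[s in LHS]vsubmxK reflC_col col_mxKu.
apply/eqP; rewrite -addr_eq0; apply/eqP.
apply: (Cplus_covector mG).
  by rewrite /Cplus /= mulmxDr (mulmxA G G) GG mul1mx addrC.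
by rewrite linearD /= reflC_usub // Cs usr addNr.
Qed.

End GeneralizedMetric.

Lemma mxdiff_reflC (R : realType) (d : nat) (U : set 'cV[R]_d) (G : 'cV[R]_d -> 'M[R]_(d + d)) x :
  open U -> U x -> (forall y, U y -> ursubmx (G y) \in unitmx) -> mxdiff G x ->
  mxdiff (fun y => reflC (G y)) x.
Proof.
move=> oU Ux uG dG.
have dur : mxdiff (fun y => ursubmx (G y)) x.
  move=> i j; rewrite (_ : (fun y => _) = fun y => G y (lshift d i) (rshift d j)) //.
  by apply/funext => y; rewrite !mxE.
have dul : mxdiff (fun y => ulsubmx (G y)) x.
  move=> i j; rewrite (_ : (fun y => _) = fun y => G y (lshift d i) (lshift d j)) //.
  by apply/funext => y; rewrite !mxE.
have db : mxdiff (fun y => bfield (G y)) x.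
  by apply: mxdiffN; apply: mxdiff_mul => //; exact: (mxdiff_invmx oU Ux uG dur).
apply: mxdiff_mul; first apply: mxdiff_mul; last first.
- by apply: mxdiff_block; try exact: mxdiff_cst; exact: mxdiffN.
- exact: mxdiff_cst.
- by apply: mxdiff_block => //; exact: mxdiff_cst.
Qed.

(** * The Bismut connection preserves the structure *)

Ltac vector_field :=
  repeat match goal with |- context [?A *m ?b] => move: (A *m b) => ? end;
  apply/matrixP => ? ?; rewrite !mxE; field.

(** The two equations say that [N_J] and [N_(GJ)] vanish on a pair formed of a
    section [s] of [C^+] and a section [t] of [C^-]: [P], [Q], [S], [T] are the
    brackets [[s, t]], [[Js, Jt]], [[s, Jt]], [[Js, t]], and [G J t = - J t].
    Their sum and difference give [T] and [S] in terms of [J P] and [J Q], and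
    [J Q] disappears from the parts in the eigenspaces of [G]. *)
Lemma eigen_split (R : realType) m (G J : 'M[R]_m) (P Q S T : 'cV[R]_m) :
  G *m G = 1%:M -> J *m G = G *m J ->
  J *m (P - Q) - S - T = 0 -> G *m J *m (P + Q) + S - T = 0 ->
  T + G *m T = J *m (P + G *m P) /\ S - G *m S = J *m (P - G *m P).
Proof.
move=> GG JG; rewrite mulmxBr -mulmxA mulmxDr mulmxDr => e1 e2.
rewrite mulmxDr mulmxBr (mulmxA J) JG -mulmxA.
move: (J *m P) (J *m Q) e1 e2 => A B e1 e2.
have eT : T = 2^-1 *: (A - B + (G *m A + G *m B)).
  have := congr2 +%R e1 e2; rewrite addr0 => e.
  by rewrite -[T]addr0 -(scaler0 _ 2^-1) -e; clear; vector_field.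
have eS : S = 2^-1 *: (A - B - (G *m A + G *m B)).
  have := congr2 (fun a b => a - b) e1 e2; rewrite subr0 => e.
  by rewrite -[S]addr0 -(scaler0 _ 2^-1) -e; clear; vector_field.
rewrite eT eS -!scalemxAr !(mulmxDr, mulmxN) !mulmxA GG !mul1mx.
by split; vector_field.
Qed.

Section BismutParallel.
Context {R : realType} {d : nat} (h : 'cV[R]_d -> form3 R d).
Context (G J : 'cV[R]_d -> 'M[R]_(d + d)) (U : set 'cV[R]_d) (x : 'cV[R]_d).
Hypotheses (oU : open U) (Ux : U x) (hx : alt_trilinear (h x)).
Hypothesis metricU : forall y, U y -> is_gen_metric (G y).
Hypothesis complexU : forall y, U y -> orthogonal_complex (J y).
Hypothesis complexGU : forall y, U y -> orthogonal_complex (G y *m J y).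
Hypothesis commU : forall y, U y -> J y *m G y = G y *m J y.
Hypotheses (dG : mxdiff G x) (dJ : mxdiff J x).
Hypothesis NJ : forall a b c, nijenhuis_at h J x a b c = 0.
Hypothesis NGJ : forall a b c, nijenhuis_at h (fun y => G y *m J y) x a b c = 0.
Implicit Types (s t : tsec R d).

Lemma kahler_bracket s t : mxdiff s x -> mxdiff t x ->
  (forall y, U y -> G y *m s y = s y) -> (forall y, U y -> G y *m t y = - t y) ->
  projp G (courant h (act J s) t) x = J x *m projp G (courant h s t) x /\
  projm G (courant h s (act J t)) x = J x *m projm G (courant h s t) x.
Proof.
move=> ds dt Cs Ct.
have oJ := complexU Ux; have oGJ := complexGU Ux.
have [_ _ GG _] := metricU Ux; have JG := commU Ux.
have dGJ : mxdiff (fun y => G y *m J y) x by exact: mxdiff_mul.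
have dJs : mxdiff (act J s) x by exact: mxdiff_mul.
have dJt : mxdiff (act J t) x by exact: mxdiff_mul.
have dGs : mxdiff (act (fun y => G y *m J y) s) x by exact: mxdiff_mul.
have dGt : mxdiff (act (fun y => G y *m J y) t) x by exact: mxdiff_mul.
have ns : \near x, act (fun y => G y *m J y) s x = act J s x.
  by apply: (near_open oU Ux) => y Uy; rewrite /act -commU // -mulmxA Cs.
have nt : \near x, act (fun y => G y *m J y) t x = - act J t x.
  by apply: (near_open oU Ux) => y Uy; rewrite /act -commU // -mulmxA Ct // mulmxN.
have nr r : \near x, r x = r x :> 'cV[R]_(d + d) by exact: (near_open oU Ux).
have := nijenhuis_vec_eq0 oJ dJ ds dt NJ.
have := nijenhuis_vec_eq0 oGJ dGJ ds dt NGJ.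
rewrite /nijenhuis_vec.
rewrite (courant_near h ns nt) // (courant_near h (nr s) nt) // (courant_near h ns (nr t)) //.
rewrite !courantNr // !opprK /projp /projm.
set P := courant h s t x; set Q := courant h _ _ x.
set S := courant h s _ x; set T := courant h _ t x => e2 e1.
have [eT eS] := eigen_split GG JG e1 e2.
by rewrite eT eS -!scalemxAr.
Qed.

Lemma mxdiff_projp s : mxdiff s x -> mxdiff (projp G s) x.
Proof.
move=> ds; rewrite (_ : projp G s = fun y => 2^-1 *: s y + 2^-1 *: (G y *m s y)).
  apply: mxdiff_lin => //; rewrite (_ : (fun y => _) = fun y => 2^-1 *: (G y *m s y) + 0).
    by apply: mxdiff_lin; [exact: mxdiff_mul | exact: mxdiff_cst].
  by apply/funext => y; rewrite addr0.
by apply/funext => y; rewrite -scalerDr.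
Qed.

Lemma mxdiff_projm s : mxdiff s x -> mxdiff (projm G s) x.
Proof.
move=> ds; rewrite (_ : projm G s = fun y => 2^-1 *: s y + - 2^-1 *: (G y *m s y)).
  apply: mxdiff_lin => //; rewrite (_ : (fun y => _) = fun y => - 2^-1 *: (G y *m s y) + 0).
    by apply: mxdiff_lin; [exact: mxdiff_mul | exact: mxdiff_cst].
  by apply/funext => y; rewrite addr0.
by apply/funext => y; rewrite scaleNr -scalerBr.
Qed.

Lemma projp_Cplus s y : U y -> G y *m projp G s y = projp G s y.
Proof.
move=> Uy; have [_ _ GG _] := metricU Uy.
by rewrite /projp -scalemxAr mulmxDr mulmxA GG mul1mx addrC.
Qed.

Lemma projm_Cminus s y : U y -> G y *m projm G s y = - projm G s y.
Proof.
move=> Uy; have [_ _ GG _] := metricU Uy.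
by rewrite /projm -scalemxAr mulmxBr mulmxA GG mul1mx -scalerN opprB.
Qed.

Lemma projp_act s y : U y -> projp G (act J s) y = act J (projp G s) y.
Proof.
by move=> Uy; rewrite /projp /act -scalemxAr mulmxDr !mulmxA commU.
Qed.

Lemma projm_act s y : U y -> projm G (act J s) y = act J (projm G s) y.
Proof.
by move=> Uy; rewrite /projm /act -scalemxAr mulmxBr !mulmxA commU.
Qed.

Lemma projp_parallel s t : mxdiff s x -> mxdiff t x ->
  (forall y, U y -> G y *m s y = - s y) ->
  projp G (courant h s (projp G (act J t))) x
  = J x *m projp G (courant h s (projp G t)) x.
Proof.
move=> ds dt Cs; have dpt := mxdiff_projp dt.
have dJpt : mxdiff (act J (projp G t)) x by exact: mxdiff_mul.
have dpJt : mxdiff (projp G (act J t)) x.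
  by apply: mxdiff_projp; exact: mxdiff_mul.
have nr r : \near x, r x = r x :> 'cV[R]_(d + d) by exact: (near_open oU Ux).
have nt : \near x, projp G (act J t) x = act J (projp G t) x.
  by apply: (near_open oU Ux) => y; exact: projp_act.
have [e _] := kahler_bracket dpt ds (fun y Uy => projp_Cplus t Uy) Cs.
rewrite {1}/projp (courant_near h (nr s) nt) // !(courant_antisym hx ds) //.
rewrite mulmxN -opprD scalerN -[_ *: (_ + _)]/(projp G _ x) e /projp.
by rewrite (courant_antisym hx ds) // mulmxN -opprD scalerN mulmxN.
Qed.

Lemma projm_parallel s t : mxdiff s x -> mxdiff t x ->
  (forall y, U y -> G y *m s y = s y) ->
  projm G (courant h s (projm G (act J t))) x
  = J x *m projm G (courant h s (projm G t)) x.
Proof.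
move=> ds dt Cs; have dpt := mxdiff_projm dt.
have dJpt : mxdiff (act J (projm G t)) x by exact: mxdiff_mul.
have dpJt : mxdiff (projm G (act J t)) x.
  by apply: mxdiff_projm; exact: mxdiff_mul.
have nr r : \near x, r x = r x :> 'cV[R]_(d + d) by exact: (near_open oU Ux).
have nt : \near x, projm G (act J t) x = act J (projm G t) x.
  by apply: (near_open oU Ux) => y; exact: projm_act.
have [_ e] := kahler_bracket ds dpt Cs (fun y Uy => projm_Cminus t Uy).
by rewrite {1}/projm (courant_near h (nr s) nt).
Qed.

(** In each of the four terms of the connection, the first argument of the
    bracket is a section of the eigenbundle of [G] opposite to that of the
    second: this is what the reflection is for in the last two terms. *)
Lemma bismut_endo_eq0 v y : bismut_endo h G J x v y = 0.
Proof.
set s : tsec R d := fun=> col_mx v 0; set t : tsec R d := fun=> y.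
have ds : mxdiff s x by exact: mxdiff_cst.
have dt : mxdiff t x by exact: mxdiff_cst.
have dC : mxdiff (fun y => reflC (G y)) x.
  by apply: (mxdiff_reflC oU Ux) => // z Uz; exact/gen_metric_unit/metricU.
suff -> : bismut_endo h G J x v y =
    bismut h G s (act J t) x - J x *m bismut h G s t x.
  apply/eqP; rewrite subr_eq0; apply/eqP; rewrite /bismut !mulmxDr.
  congr (_ + _ + _ + _).
  - apply: projp_parallel => //; first exact: mxdiff_projm.
    by move=> z Uz; exact: projm_Cminus.
  - apply: projm_parallel => //; first exact: mxdiff_projp.
    by move=> z Uz; exact: projp_Cplus.
  - apply: projm_parallel => //; first by apply: mxdiff_mul => //; exact: mxdiff_projm.
    by move=> z Uz; apply: reflC_Cminus; [exact: metricU | exact: projm_Cminus].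
  - apply: projp_parallel => //; first by apply: mxdiff_mul => //; exact: mxdiff_projp.
    by move=> z Uz; apply: reflC_Cplus; [exact: metricU | exact: projp_Cplus].
by [].
Qed.

End BismutParallel.

(** * The fibre in stereographic coordinates *)

Lemma matrix_ext (R : realType) m n (A B : 'M[R]_(m, n)) :
  (forall v : 'cV[R]_n, A *m v = B *m v) -> A = B.
Proof.
move=> AB; apply/matrixP => i j; have := AB (basis_vec j) => /matrixP /(_ i 0).
by rewrite /basis_vec -!colE !mxE.
Qed.

Section Stereographic.
Context {R : realType}.
Implicit Types (e : bool) (z w : 'cV[R]_2).

Lemma col3E (a b c : R) : [/\ col3 a b c (inord 0) 0 = a,
  col3 a b c (inord 1) 0 = b & col3 a b c (inord 2) 0 = c].
Proof. by split; rewrite mxE inordK. Qed.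

Lemma col3_inord (u : 'cV[R]_3) :
  u = col3 (u (inord 0) 0) (u (inord 1) 0) (u (inord 2) 0).
Proof.
apply/matrixP => i j; rewrite !ord1 !mxE.
case: i => [[|[|[|//]]] lt3] /=; congr (u _ _); apply: val_inj; by rewrite /= inordK.
Qed.

Definition stereo_den z : R := 1 + (z 0 0 ^+ 2 + z 1 0 ^+ 2).

Lemma stereo_den_neq0 z : stereo_den z != 0.
Proof. by rewrite lt0r_neq0 // ltr_pwDl ?ltr01 // addr_ge0 ?sqr_ge0. Qed.

Definition stereo_num e z : 'cV[R]_3 :=
  col3 (2 * z 0 0) (2 * z 1 0) (pole e * (stereo_den z - 2)).

Lemma stereo_invE e z : stereo_inv e z = (stereo_den z)^-1 *: stereo_num e z.
Proof.
rewrite /stereo_inv /stereo_num /stereo_den; congr (_ *: col3 _ _ (_ * _)).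
ring.
Qed.

Definition stereo_dden z w : R := 2 * (z 0 0 * w 0 0 + z 1 0 * w 1 0).

Lemma is_derive_coord z w (i : 'I_2) :
  is_derive z w (fun y : 'cV[R]_2 => y i 0 : R) (w i 0).
Proof.
apply: DeriveDef; first exact/diff_derivable/differentiable_coord.
rewrite /derive; apply: cvg_lim => //.
apply: cvg_near_cst; near=> t.
rewrite /= !mxE addrK /GRing.scale /= mulrA mulVf ?mul1r //.
by near: t; exact: nbhs_dnbhs_neq.
Unshelve. all: by end_near. Qed.

Lemma is_derive_stereo_den z w : is_derive z w stereo_den (stereo_dden z w).
Proof.
have dX := is_derive_coord z w 0; have dY := is_derive_coord z w 1.
pose X (y : 'cV[R]_2) : R := y 0 0; pose Y (y : 'cV[R]_2) : R := y 1 0.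
rewrite (_ : stereo_den = cst 1 + (X * X + Y * Y)); last exact/funext.
have dXX : is_derive z w (X * X) (X z *: w 0 0 + X z *: w 0 0) by exact: is_deriveM.
have dYY : is_derive z w (Y * Y) (Y z *: w 1 0 + Y z *: w 1 0) by exact: is_deriveM.
have dXY := is_deriveD dXX dYY; have d1 := is_derive_cst (1 : R) z w.
have -> : stereo_dden z w =
    0 + (X z *: w 0 0 + X z *: w 0 0 + (Y z *: w 1 0 + Y z *: w 1 0)).
  rewrite /stereo_dden /X /Y /GRing.scale /=.
  move: (z 0 0) (z 1 0) (w 0 0) (w 1 0) => a b a' b'; ring.
exact: is_deriveD.
Qed.

Lemma is_derive_stereo_num e z w i : is_derive z w (fun y => stereo_num e y i 0)
  (col3 (2 * w 0 0) (2 * w 1 0) (pole e * stereo_dden z w) i 0).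
Proof.
have dX := is_derive_coord z w 0; have dY := is_derive_coord z w 1.
have dD := is_derive_stereo_den z w.
case: i => [[|[|[|//]]] lt3].
- rewrite (_ : (fun y => _) = 2 *: (fun y : 'cV[R]_2 => y 0 0)).
    by apply: is_derive_eq; rewrite mxE.
  by apply/funext => y; rewrite mxE.
- rewrite (_ : (fun y => _) = 2 *: (fun y : 'cV[R]_2 => y 1 0)).
    by apply: is_derive_eq; rewrite mxE.
  by apply/funext => y; rewrite mxE.
- rewrite (_ : (fun y => _) = pole e *: (stereo_den - cst 2)).
    by apply: is_derive_eq; rewrite mxE /= subr0.
  by apply/funext => y; rewrite mxE.
Qed.

Definition dstereo e z w : 'cV[R]_3 :=
  (stereo_den z)^-1 *: col3 (2 * w 0 0) (2 * w 1 0) (pole e * stereo_dden z w)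
  - ((stereo_den z)^-1 ^+ 2 * stereo_dden z w) *: stereo_num e z.

Lemma is_derive_stereo_inv e z w i :
  is_derive z w (fun y => stereo_inv e y i 0) (dstereo e z w i 0).
Proof.
have dD := is_derive_stereo_den z w; have dN := is_derive_stereo_num e z w i.
have D0 := stereo_den_neq0 z.
rewrite (_ : (fun y => _) = (fun y => (stereo_den y)^-1) * (fun y => stereo_num e y i 0)).
  have dV : is_derive z w (fun y => (stereo_den y)^-1)
      (- (stereo_den z)^-1 ^+ 2 *: stereo_dden z w).
    have dD' := @ex_derive _ _ _ _ _ _ _ dD.
    apply: DeriveDef; first exact: derivableV.
    by rewrite (deriveV D0 dD') (@derive_val _ _ _ _ _ _ _ dD) exprVn.
  apply: is_derive_eq (is_deriveM dV dN) _.
  rewrite [dstereo e z w i 0]mxE [X in _ = X + _]mxE [X in _ = _ + X]mxE.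
  rewrite [X in _ = _ + - X]mxE.
  move: (stereo_num e z i 0) (col3 _ _ _ i 0) => a b.
  rewrite /GRing.scale /=; move: (stereo_den z)^-1 (stereo_dden z w) => u v; ring.
by apply/funext => y; rewrite stereo_invE mxE.
Qed.

Lemma differentiable_stereo_den z : differentiable stereo_den z.
Proof.
have dX := @differentiable_coord R 2 1 z 0 0; have dY := @differentiable_coord R 2 1 z 1 0.
rewrite (_ : stereo_den = cst 1 + ((fun y : 'cV[R]_2 => y 0 0 : R) ^+ 2 + (fun y : 'cV[R]_2 => y 1 0 : R) ^+ 2)).
  apply: differentiableD; first exact: differentiable_cst.
  by apply: differentiableD; exact: differentiableX.
by apply/funext => y.
Qed.

Lemma mxdiff_stereo_inv e z : mxdiff (stereo_inv e) z.
Proof.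
move=> i j; rewrite ord1.
have dX := @differentiable_coord R 2 1 z 0 0; have dY := @differentiable_coord R 2 1 z 1 0.
have dD := differentiable_stereo_den z.
rewrite (_ : (fun y => _) = (fun y => (stereo_den y)^-1) * (fun y => stereo_num e y i 0)).
  apply: differentiableM; first exact: (differentiableV dD (stereo_den_neq0 z)).
  case: i => [[|[|[|//]]] lt3].
  - rewrite (_ : (fun y => _) = 2 *: (fun y : 'cV[R]_2 => y 0 0)).
      exact: differentiableZ.
    by apply/funext => y; rewrite mxE.
  - rewrite (_ : (fun y => _) = 2 *: (fun y : 'cV[R]_2 => y 1 0)).
      exact: differentiableZ.
    by apply/funext => y; rewrite mxE.
  - rewrite (_ : (fun y => _) = pole e *: (stereo_den - cst 2)).
      by apply: differentiableZ; apply: differentiableB => //; exact: differentiable_cst.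
    by apply/funext => y; rewrite mxE.
by apply/funext => y; rewrite stereo_invE mxE.
Qed.

Lemma ddir_stereo_inv e z w : ddir w (stereo_inv e) z = dstereo e z w.
Proof.
by apply/matrixP => i j; rewrite ord1 mxE (@derive_val _ _ _ _ _ _ _ (is_derive_stereo_inv e z w i)).
Qed.

Lemma jac_stereo_inv e z w : jac (stereo_inv e) z *m w = dstereo e z w.
Proof. by rewrite jac_mul ?ddir_stereo_inv //; exact: mxdiff_stereo_inv. Qed.

(** Stereographic projection is conformal, so the complex structure of the
    sphere is a rotation by a right angle, whose sense depends on the pole. *)
Definition quarter_turn e : 'M[R]_2 :=
  \matrix_(i, j) (pole e * ((j : nat)%:R - (i : nat)%:R)).

Lemma quarter_turn_mul e w : (quarter_turn e *m w) 0 0 = pole e * w 1 0 /\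
  (quarter_turn e *m w) 1 0 = - pole e * w 0 0.
Proof.
have l1 : lift (ord0 : 'I_2) (ord0 : 'I_1) = 1 by exact: val_inj.
have sum2 (f : 'I_2 -> R) : \sum_i f i = f 0 + f 1.
  by rewrite 2!big_ord_recl big_ord0 l1 addr0.
split; rewrite [LHS]mxE sum2 [quarter_turn e _ _]mxE [quarter_turn e _ 1]mxE /=.
  by rewrite subrr subr0 mulr0 mul0r add0r mulr1.
by rewrite subrr sub0r mulr0 mul0r addr0 mulrN1.
Qed.

Lemma stereo_inv_comp e z : [/\
  stereo_inv e z (inord 0) 0 = (stereo_den z)^-1 * (2 * z 0 0),
  stereo_inv e z (inord 1) 0 = (stereo_den z)^-1 * (2 * z 1 0) &
  stereo_inv e z (inord 2) 0 = (stereo_den z)^-1 * (pole e * (stereo_den z - 2))].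
Proof. by rewrite stereo_invE; split; rewrite !mxE inordK. Qed.

Lemma poleE e : pole e = 1 - 2 * e%:R :> R.
Proof. by case: e; rewrite /pole /= ?expr0 ?expr1; ring. Qed.

Lemma stereo_inv_norm e z : stereo_inv e z (inord 0) 0 ^+ 2
  + stereo_inv e z (inord 1) 0 ^+ 2 + stereo_inv e z (inord 2) 0 ^+ 2 = 1.
Proof.
have [-> -> ->] := stereo_inv_comp e z; have D0 := stereo_den_neq0 z.
rewrite poleE.
move: D0; rewrite /stereo_den; case: e => D0 /=; field; exact: D0.
Qed.

Lemma dstereo_comp e z w :
  let D := stereo_den z in let D' := stereo_dden z w in [/\
  dstereo e z w (inord 0) 0 = D^-1 * (2 * w 0 0) - D^-1 ^+ 2 * D' * (2 * z 0 0),
  dstereo e z w (inord 1) 0 = D^-1 * (2 * w 1 0) - D^-1 ^+ 2 * D' * (2 * z 1 0) &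
  dstereo e z w (inord 2) 0 = D^-1 * (pole e * D') - D^-1 ^+ 2 * D' * (pole e * (D - 2))].
Proof. by split; rewrite !mxE inordK. Qed.

Lemma dstereo_orth e z w :
  let u := stereo_inv e z in let v := dstereo e z w in
  u (inord 0) 0 * v (inord 0) 0 + u (inord 1) 0 * v (inord 1) 0
  + u (inord 2) 0 * v (inord 2) 0 = 0.
Proof.
move=> u v; rewrite {}/u {}/v; have [-> -> ->] := stereo_inv_comp e z.
have [-> -> ->] := dstereo_comp e z w; have D0 := stereo_den_neq0 z.
rewrite poleE.
move: D0; rewrite /stereo_dden /stereo_den; case: e => D0 /=; field; exact: D0.
Qed.

Lemma dstereo_quarter_turn e z w :
  dstereo e z (quarter_turn e *m w) = cross (stereo_inv e z) (dstereo e z w).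
Proof.
rewrite /cross [LHS]col3_inord.
have [-> -> ->] := stereo_inv_comp e z; have [-> -> ->] := dstereo_comp e z w.
have [-> -> ->] := dstereo_comp e z (quarter_turn e *m w).
rewrite /stereo_dden; have [-> ->] := quarter_turn_mul e w; have D0 := stereo_den_neq0 z.
rewrite poleE.
move: D0; rewrite /stereo_den; case: e => D0 /=; congr col3; field; exact: D0.
Qed.

Lemma dstereo_inj e z w : dstereo e z w = 0 -> w = 0.
Proof.
move=> v0; have D0 := stereo_den_neq0 z.
have [e0 e1 e2] := dstereo_comp e z w; rewrite v0 !mxE in e0 e1 e2.
have p0 : pole e != 0 :> R by rewrite signr_eq0.
have D'0 : stereo_dden z w = 0.
  have c0 : pole e * (2 * (stereo_den z)^-1 ^+ 2) != 0.
    by apply: mulf_neq0 p0 (mulf_neq0 _ (expf_neq0 _ (invr_neq0 D0))); rewrite pnatr_eq0.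
  apply: (mulfI c0); rewrite mulr0 [RHS]e2; field; exact: D0.
move: e0 e1; rewrite D'0 mulr0 !mul0r !subr0.
have aux (a : R) : 0 = (stereo_den z)^-1 * (2 * a) -> a = 0.
  by move/esym/eqP; rewrite !mulf_eq0 invr_eq0 (negPf D0) pnatr_eq0 /= => /eqP.
move=> /aux w0 /aux w1; apply/matrixP => i j; rewrite ord1 [RHS]mxE.
case: i => [[|[|//]] lt2].
  by rewrite -[RHS]w0; congr (w _ _); exact: val_inj.
by rewrite -[RHS]w1; congr (w _ _); exact: val_inj.
Qed.

Lemma dstereoB e z w w' : dstereo e z (w - w') = dstereo e z w - dstereo e z w'.
Proof. by rewrite -!jac_stereo_inv mulmxBr. Qed.

Lemma fibreJE e z : fibreJ e z = quarter_turn e.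
Proof.
apply: xget_subset1 => [w|B B' /= HB HB'].
  by rewrite !jac_stereo_inv dstereo_quarter_turn.
apply: matrix_ext => w; apply/eqP; rewrite -subr_eq0; apply/eqP.
apply: (@dstereo_inj e z); rewrite dstereoB -!jac_stereo_inv HB HB'.
by rewrite subrr.
Qed.

Lemma quarter_turn_sq e : quarter_turn e *m quarter_turn e = - 1%:M.
Proof.
apply: matrix_ext => w; rewrite -mulmxA mulNmx mul1mx.
have e2 : pole e * pole e = 1 :> R by rewrite -expr2 sqrr_sign.
have [r0 r1] := quarter_turn_mul e (quarter_turn e *m w); have [w0 w1] := quarter_turn_mul e w.
apply/matrixP => i j; rewrite ord1 [RHS]mxE.
case: i => [[|[|//]] lt2].
  have -> : Ordinal lt2 = 0 by exact: val_inj.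
  by rewrite r0 w1 mulrA mulrN e2 mulN1r.
have -> : Ordinal lt2 = 1 by exact: val_inj.
by rewrite r1 w0 mulrA mulNr e2 mulN1r.
Qed.

End Stereographic.

(** * Quaternions and the horizontal lift *)

Section QuaternionProduct.
Context {R : realType} {m : nat} (I J K : 'M[R]_m).
Hypotheses (II : I *m I = - 1%:M) (JJ : J *m J = - 1%:M) (KK : K *m K = - 1%:M).
Hypotheses (IJ : I *m J = K) (JI : J *m I = - K) (JK : J *m K = I)
  (KJ : K *m J = - I) (KI : K *m I = J) (IK : I *m K = - J).
Implicit Types u v : 'cV[R]_3.

Lemma quat_mul u v :
  quat I J K u *m quat I J K v = quat I J K (cross u v)
  - (u (inord 0) 0 * v (inord 0) 0 + u (inord 1) 0 * v (inord 1) 0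
     + u (inord 2) 0 * v (inord 2) 0) *: 1%:M.
Proof.
rewrite /quat /cross; set c := col3 _ _ _.
have [-> -> ->] : [/\ c (inord 0) 0 = u (inord 1) 0 * v (inord 2) 0 - u (inord 2) 0 * v (inord 1) 0,
  c (inord 1) 0 = u (inord 2) 0 * v (inord 0) 0 - u (inord 0) 0 * v (inord 2) 0 &
  c (inord 2) 0 = u (inord 0) 0 * v (inord 1) 0 - u (inord 1) 0 * v (inord 0) 0] by exact: col3E.
rewrite !(mulmxDl, mulmxDr) -!scalemxAl -!scalemxAr !scalerA.
rewrite II JJ KK IJ JI JK KJ KI IK; move: 1%:M => E; clear.
by apply/matrixP => i j; rewrite !mxE; ring.
Qed.

Lemma cross_self u : cross u u = 0.
Proof.
apply/matrixP => i j; rewrite [in LHS]/cross !mxE.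
by case: i => [[|[|[|//]]] ?] /=; rewrite mulrC subrr.
Qed.

Lemma quat0 : quat I J K 0 = 0.
Proof. by rewrite /quat !mxE !scale0r !addr0. Qed.

(** The square of [u] is minus its squared length; [m] is nonzero since all
    matrices of size 0 are equal. *)
Lemma quat_eq0 u : (0 < m)%N -> quat I J K u = 0 -> u = 0.
Proof.
move=> m0 u0; have := quat_mul u u; rewrite u0 mul0mx cross_self quat0 sub0r.
move/esym/eqP; rewrite oppr_eq0 => /eqP /matrixP /(_ (Ordinal m0) (Ordinal m0)).
rewrite !mxE eqxx mulr1 -!expr2 => /eqP.
rewrite !paddr_eq0 ?addr_ge0 ?sqr_ge0 // !sqrf_eq0 => /andP [/andP [/eqP a /eqP b] /eqP c].
by rewrite [u]col3_inord a b c; apply/matrixP => i j; rewrite !mxE; case: i => [[|[|[|//]]] ?].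
Qed.

End QuaternionProduct.

Section HorizontalLift.
Context {R : realType} {d : nat} (h : 'cV[R]_d -> form3 R d).
Context (G I J K : 'cV[R]_d -> 'M[R]_(d + d)) (x : 'cV[R]_d).
Hypothesis qx : quaternionic I J K x.
Hypotheses (DI : forall v y, bismut_endo h G I x v y = 0)
  (DJ : forall v y, bismut_endo h G J x v y = 0)
  (DK : forall v y, bismut_endo h G K x v y = 0).

Lemma quat_eq0_at u : (0 < d)%N -> quat (I x) (J x) (K x) u = 0 -> u = 0.
Proof.
have [oI oJ oK IJ JI] := qx; have [_ _ _ JK KJ] := quaternionic_rot qx.
have [_ _ _ KI IK] := quaternionic_rot (quaternionic_rot qx).
move=> d0; apply: quat_eq0 => //; [exact: oI.1 | exact: oJ.1 | exact: oK.1 |].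
by rewrite addn_gt0 d0.
Qed.

Lemma quat_mul_at u v :
  quat (I x) (J x) (K x) u *m quat (I x) (J x) (K x) v
  = quat (I x) (J x) (K x) (cross u v)
  - (u (inord 0) 0 * v (inord 0) 0 + u (inord 1) 0 * v (inord 1) 0
     + u (inord 2) 0 * v (inord 2) 0) *: 1%:M.
Proof.
have [oI oJ oK IJ JI] := qx; have [_ _ _ JK KJ] := quaternionic_rot qx.
have [_ _ _ KI IK] := quaternionic_rot (quaternionic_rot qx).
by apply: quat_mul => //; [exact: oI.1 | exact: oJ.1 | exact: oK.1].
Qed.

(** With [D I = D J = D K = 0] the lift solves [quat (jac (L v)) = 0].  In
    dimension 0 the quaternion units are all zero, but [L] has no column. *)
Lemma hlift_eq0 e z : hlift h G I J K e x z = 0.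
Proof.
apply: xget_subset1 => [v y|].
  rewrite /= mul0mx mulmx0 quat0 mul0mx DI DJ DK.
  by rewrite !scaler0 !addr0.
suff uniq L : (forall v y, quat (I x) (J x) (K x) (jac (stereo_inv e) z *m (L *m v)) *m y
    + (stereo_inv e z (inord 0) 0 *: bismut_endo h G I x v y
       + stereo_inv e z (inord 1) 0 *: bismut_endo h G J x v y
       + stereo_inv e z (inord 2) 0 *: bismut_endo h G K x v y) = 0) -> L = 0.
  by move=> L L' /uniq -> /uniq ->.
move=> HL; have [d0|] := posnP d.
  by apply/matrixP => i j; have := ltn_ord j; rewrite {2}d0.
move=> d0; apply: matrix_ext => v; rewrite mul0mx; apply: (@dstereo_inj _ e z).
rewrite -jac_stereo_inv; apply: (quat_eq0_at d0); apply: matrix_ext => y.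
by rewrite mul0mx -[RHS](HL v y) DI DJ DK !scaler0 !addr0.
Qed.

End HorizontalLift.

(** * Endomorphisms preserving the product splitting *)

Section SplitTwistor.
Context {R : realType} {d : nat}.
Implicit Types (a b : 'cV[R]_((d + 2) + (d + 2))).

Definition hor a : 'cV[R]_(d + d) := usubmx (unglue 0 *m a).
Definition ver a : 'cV[R]_(2 + 2) := dsubmx (unglue 0 *m a).

Lemma unglue0_col (X xi : 'cV[R]_d) (w eta : 'cV[R]_2) :
  unglue 0 *m col_mx (col_mx X w) (col_mx xi eta)
  = col_mx (col_mx X xi) (col_mx w eta).
Proof.
rewrite /unglue !mul_block_col trmx0 oppr0.
by rewrite !(mul0mx, mul1mx, addr0, add0r) !add_col_mx !(addr0, add0r).
Qed.

Lemma dotv_col m n (x y : 'cV[R]_m) (z t : 'cV[R]_n) :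
  dotv (col_mx x z) (col_mx y t) = dotv x y + dotv z t.
Proof. by rewrite /dotv tr_col_mx mul_row_col mxE. Qed.

Lemma pairing_hor_ver a b :
  pairing a b = pairing (hor a) (hor b) + pairing (ver a) (ver b).
Proof.
rewrite /hor /ver -[a]vsubmxK -[b]vsubmxK -[usubmx a]vsubmxK -[dsubmx a]vsubmxK.
rewrite -[usubmx b]vsubmxK -[dsubmx b]vsubmxK !unglue0_col !col_mxKu !col_mxKd.
by rewrite !pairing_col !dotv_col; ring.
Qed.

Lemma usubmx_hor a : usubmx (usubmx a) = usubmx (hor a).
Proof.
rewrite /hor -[a]vsubmxK -[usubmx a]vsubmxK -[dsubmx a]vsubmxK unglue0_col.
by rewrite !col_mxKu.
Qed.

Lemma dsubmx_ver a : dsubmx (usubmx a) = usubmx (ver a).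
Proof.
rewrite /ver -[a]vsubmxK -[usubmx a]vsubmxK -[dsubmx a]vsubmxK unglue0_col.
by rewrite !col_mxKu !col_mxKd !col_mxKu.
Qed.

Definition split_endo (u : 'M[R]_(d + d)) (v : 'M[R]_(2 + 2)) :
    'M[R]_((d + 2) + (d + 2)) :=
  Defs.glue 0 *m block_mx u 0 0 v *m unglue 0.

Lemma hor_split u v a : hor (split_endo u v *m a) = u *m hor a.
Proof.
rewrite /hor /split_endo !mulmxA glueK mul1mx -mulmxA -[unglue 0 *m a]vsubmxK.
by rewrite mul_block_col mul0mx addr0 !col_mxKu.
Qed.

Lemma ver_split u v a : ver (split_endo u v *m a) = v *m ver a.
Proof.
rewrite /ver /split_endo !mulmxA glueK mul1mx -mulmxA -[unglue 0 *m a]vsubmxK.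
by rewrite mul_block_col !mul0mx add0r !col_mxKd.
Qed.

Lemma hor_ver_inj a b : hor a = hor b -> ver a = ver b -> a = b.
Proof.
move=> eh ev; rewrite -[a]mul1mx -[b]mul1mx -(unglueK 0) -!mulmxA.
by rewrite -[unglue 0 *m a]vsubmxK -[unglue 0 *m b]vsubmxK -/(hor a) -/(ver a) eh ev.
Qed.

Lemma split_orthogonal_complex u (B : 'M[R]_2) :
  orthogonal_complex u -> B *m B = - 1%:M ->
  orthogonal_complex (split_endo u (block_mx B 0 0 (- B^T))).
Proof.
move=> [uu uskew] BB; split.
  apply: matrix_ext => a; rewrite -mulmxA mulNmx mul1mx.
  apply: hor_ver_inj.
    rewrite !hor_split mulmxA uu mulNmx mul1mx /hor mulmxN.
    by rewrite linearN.
  rewrite !ver_split mulmxA mulmx_block !mul0mx !mulmx0 !addr0 add0r BB.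
  rewrite mulmxN mulNmx opprK -trmx_mul BB linearN /= trmx1.
  rewrite /ver mulmxN linearN /= -[dsubmx (unglue 0 *m a)]vsubmxK.
  by rewrite mul_block_col !mul0mx addr0 add0r !mulNmx !mul1mx opp_col_mx.
move=> a b; rewrite !pairing_hor_ver !hor_split !ver_split uskew.
rewrite opprD; congr (_ + _).
rewrite -[ver a]vsubmxK -[ver b]vsubmxK !mul_block_col !mul0mx !addr0 !add0r.
rewrite !pairing_col !mulNmx !dotvNl (dotvC (B^T *m _)).
rewrite !(dotvC (dsubmx (ver b))) !dotv_mul.
rewrite [dotv _ (B^T *m _)]dotvC dotv_mul (dotvC (B *m _) (dsubmx _)).
gen_pairings; ring.
Qed.

(** Dependence on [u] in a form to which the product rule applies. *)
Lemma split_endo_affine u v : split_endo u v =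
  Defs.glue 0 *m col_mx 1%:M 0 *m u *m (row_mx 1%:M 0 *m unglue 0)
  + split_endo 0 v.
Proof.
rewrite /split_endo -!mulmxA -mulmxDr; congr (_ *m _).
rewrite !mulmxA -mulmxDl; congr (_ *m _).
rewrite mul_col_mx mul1mx mul0mx mul_mx_row mulmx1 mulmx0.
by rewrite -[X in row_mx _ X]col_mx0 -block_mxEh add_block_mx !addr0 !add0r.
Qed.

Definition pullback (h : 'cV[R]_d -> form3 R d) : 'cV[R]_(d + 2) -> form3 R (d + 2) :=
  fun q X Y Z => h (usubmx q) (usubmx X) (usubmx Y) (usubmx Z).

Lemma pullback_trilinear h q : alt_trilinear (h (usubmx q)) ->
  alt_trilinear (pullback h q).
Proof.
case=> lin s1 s2; split=> [a X X' Y Z|X Y Z|X Y Z]; rewrite /pullback.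
- by rewrite linearP /= lin.
- exact: s1.
- exact: s2.
Qed.

(** The sum over the basis reduces to the base: [h] is zero on a vector of the
    fibre. *)
Lemma hpair_pullback h q a b c : alt_trilinear (h (usubmx q)) ->
  hpair (pullback h q) a b c = hpair (h (usubmx q)) (hor a) (hor b) (hor c).
Proof.
case=> lin s1 s2; rewrite /hpair -!usubmx_hor !dotvE big_split_ord /=.
have w0 X Y : h (usubmx q) X Y 0 = 0.
  have z0 X' Y' : h (usubmx q) 0 X' Y' = 0.
    have := lin 1 0 0 X' Y'; rewrite scale1r addr0 mul1r => e.
    by apply: (addrI (h (usubmx q) 0 X' Y')); rewrite addr0 -e.
  by rewrite s2 s1 opprK z0.
rewrite [X in _ + X]big1 ?addr0 => [|i _]; last first.
  rewrite mxE /pullback (_ : usubmx (basis_vec _) = 0) ?w0 ?mul0r //.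
  apply/matrixP => r c'; rewrite !mxE -val_eqE /=.
  by rewrite ltn_eqF // ltn_addr.
congr (_ * _); apply: eq_bigr => i _; rewrite !mxE; congr (h _ _ _ _ * _).
by apply/matrixP => r c'; rewrite !mxE.
Qed.

(** [A] is the derivative of the structure [u] along the base and [Q] along the
    fibre.  The hypothesis on [Q] is the Cauchy-Riemann equation for the map from
    the fibre to the structures.  It turns each term with a derivative along
    [B t] into [pairing (u (Q t a)) (u b) = pairing (Q t a) b], which cancels
    against the corresponding term with a derivative along [t]. *)
Lemma nijenhuis_split (w : form3 R d) (wZ : form3 R (d + 2)) (u : 'M[R]_(d + d))
    (B : 'M[R]_2) (A : 'cV[R]_d -> 'M[R]_(d + d)) (Q : 'cV[R]_2 -> 'M[R]_(d + d)) a b c :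
  (forall a b c, hpair wZ a b c = hpair w (hor a) (hor b) (hor c)) ->
  orthogonal_complex u -> (forall t, Q (B *m t) = u *m Q t) ->
  nijenhuis wZ (split_endo u (block_mx B 0 0 (- B^T)))
    (fun v => split_endo (A (usubmx v) + Q (dsubmx v)) 0) a b c
  = nijenhuis w u A (hor a) (hor b) (hor c).
Proof.
move=> hw [uu uskew] QB; set W := split_endo u _.
have iso s t : pairing (u *m s) (u *m t) = pairing s t.
  by rewrite uskew mulmxA uu mulNmx mul1mx pairingNr opprK.
have horW s : hor (W *m s) = u *m hor s by exact: hor_split.
have uW s : usubmx (usubmx (W *m s)) = usubmx (u *m hor s) by rewrite usubmx_hor horW.
have dW s : dsubmx (usubmx (W *m s)) = B *m usubmx (ver s).
  rewrite dsubmx_ver ver_split -{1}[ver s]vsubmxK mul_block_col.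
  by rewrite mul0mx addr0 col_mxKu.
have pl X s t : pairing (split_endo X 0 *m s) t = pairing (X *m hor s) (hor t).
  rewrite pairing_hor_ver hor_split ver_split mul0mx.
  by rewrite pairing0l addr0.
have pr X s t : pairing t (split_endo X 0 *m s) = pairing (hor t) (X *m hor s).
  by rewrite pairingC pl pairingC.
rewrite /nijenhuis !hw !pl !pr !horW !uW !dW !usubmx_hor !dsubmx_ver.
rewrite !QB !(mulmxDl (A _)) !(pairingDl (A _ *m _)) !(pairingDr (A _ *m _)).
rewrite -!(mulmxA u (Q _)) !iso.
gen_pairings.
do 4![move: (hpair _ _ _ _) => ?].
by field.
Qed.

End SplitTwistor.

(** * The structure of the twistor space *)

Section TwistorNijenhuis.
Context {R : realType} {d : nat} (h : 'cV[R]_d -> form3 R d).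
Context (I J K : 'cV[R]_d -> 'M[R]_(d + d)) (e : bool).
Implicit Types (q v : 'cV[R]_(d + 2)) (x : 'cV[R]_d).

Definition twistor_u q : 'M[R]_(d + d) :=
  quat (I (usubmx q)) (J (usubmx q)) (K (usubmx q)) (stereo_inv e (dsubmx q)).

Definition twistor_endo q : 'M[R]_((d + 2) + (d + 2)) :=
  split_endo (twistor_u q) (block_mx (quarter_turn e) 0 0 (- (quarter_turn e)^T)).

Lemma stereo_coord q k : differentiable (fun y => stereo_inv e (dsubmx y) k 0) q.
Proof. exact: (@mxdiff_comp_dsubmx R d 2 _ _ (stereo_inv e) q (mxdiff_stereo_inv e _) k 0). Qed.

Lemma derive_stereo_coord q v k : 'D_v (fun y => stereo_inv e (dsubmx y) k 0) q =
  dstereo e (dsubmx q) (dsubmx v) k 0.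
Proof.
have := ddir_comp_dsubmx (stereo_inv e) q v => /matrixP /(_ k 0).
by rewrite ddir_stereo_inv mxE.
Qed.

Lemma mxdiff_twistor_u q : mxdiff I (usubmx q) -> mxdiff J (usubmx q) ->
  mxdiff K (usubmx q) -> mxdiff twistor_u q.
Proof.
move=> dI dJ dK; rewrite /twistor_u /quat.
by apply: mxdiffD; first apply: mxdiffD; apply: mxdiff_scale;
  do ?exact: stereo_coord; exact: mxdiff_comp_usubmx.
Qed.

Lemma ddir_twistor_u q v : mxdiff I (usubmx q) -> mxdiff J (usubmx q) ->
  mxdiff K (usubmx q) ->
  let x := usubmx q in let u := stereo_inv e (dsubmx q) in
  ddir v twistor_u q =
  ddir (usubmx v) (combo I J K (u (inord 0) 0) (u (inord 1) 0) (u (inord 2) 0)) x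
  + quat (I x) (J x) (K x) (dstereo e (dsubmx q) (dsubmx v)).
Proof.
move=> dI dJ dK x u; rewrite /twistor_u /quat.
have dIq := mxdiff_comp_usubmx dI; have dJq := mxdiff_comp_usubmx dJ.
have dKq := mxdiff_comp_usubmx dK.
have dsc F k : mxdiff F q ->
    mxdiff (fun y => stereo_inv e (dsubmx y) k 0 *: F y : 'M[R]_(d + d)) q.
  by move=> dF; apply: mxdiff_scale => //; exact: stereo_coord.
rewrite ddirD; [|by apply: mxdiffD; exact: dsc|exact: dsc].
rewrite ddirD; [|exact: dsc|exact: dsc].
rewrite !ddir_scale //; do ?exact: stereo_coord.
rewrite !ddir_comp_usubmx !derive_stereo_coord.
have cst_diff (a : R) y : differentiable (fun=> a) y by exact: differentiable_cst.
have dsx F (a : R) : mxdiff F x -> mxdiff (fun y => a *: F y : 'M[R]_(d + d)) x.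
  by move=> dF; apply: (mxdiff_scale (f := fun=> a)).
have ddsx F (a : R) w : mxdiff F x ->
    ddir w (fun y => a *: F y : 'M[R]_(d + d)) x = a *: ddir w F x.
  by move=> dF; rewrite (ddir_scale (f := fun=> a)) // derive_cst scale0r addr0.
rewrite /combo ddirD; [|by apply: mxdiffD; exact: dsx|exact: dsx].
rewrite ddirD; [|exact: dsx|exact: dsx].
rewrite !ddsx //.
by rewrite [X in X + _ = _]addrACA [LHS]addrACA.
Qed.

Lemma twistor_endo_affine q : twistor_endo q =
  Defs.glue 0 *m col_mx 1%:M 0 *m twistor_u q *m (row_mx 1%:M 0 *m unglue 0)
  + split_endo 0 (block_mx (quarter_turn e) 0 0 (- (quarter_turn e)^T)).
Proof. exact: split_endo_affine. Qed.

Lemma mxdiff_twistor_endo q : mxdiff twistor_u q -> mxdiff twistor_endo q.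
Proof.
move=> du; rewrite (funext twistor_endo_affine).
apply: mxdiffD; last exact: mxdiff_cst.
apply: mxdiff_mul; last exact: mxdiff_cst.
by apply: mxdiff_mul => //; exact: mxdiff_cst.
Qed.

Lemma ddir_twistor_endo q v : mxdiff twistor_u q ->
  ddir v twistor_endo q = split_endo (ddir v twistor_u q) 0.
Proof.
move=> du; rewrite (funext twistor_endo_affine).
have dPu : mxdiff (fun q => Defs.glue 0 *m col_mx 1%:M 0 *m twistor_u q) q.
  by apply: mxdiff_mul => //; exact: mxdiff_cst.
rewrite ddirD; [|by apply: mxdiff_mul => //; exact: mxdiff_cst|exact: mxdiff_cst].
rewrite ddir_cst addr0 ddir_mul; [|exact: dPu|exact: mxdiff_cst].
rewrite ddir_cst mulmx0 addr0 ddir_mul; [|exact: mxdiff_cst|exact: du].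
rewrite ddir_cst mul0mx add0r [RHS]split_endo_affine.
have -> : split_endo 0 0 = 0 :> 'M[R]_((d + 2) + (d + 2)).
  by rewrite /split_endo block_mx0 mulmx0 mul0mx.
by rewrite addr0.
Qed.

(** For orthogonal imaginary quaternions the product is the cross product, by
    which the complex structure of the sphere is defined: this gives the
    Cauchy-Riemann equation of [nijenhuis_split]. *)
Lemma nijenhuis_twistor (U : set 'cV[R]_d) q x : usubmx q = x ->
  open U -> U x -> alt_trilinear (h x) ->
  (forall y, U y -> quaternionic I J K y) ->
  mxdiff I x -> mxdiff J x -> mxdiff K x ->
  (forall a b c, nijenhuis_at h I x a b c = 0) ->
  (forall a b c, nijenhuis_at h J x a b c = 0) ->
  (forall a b c, nijenhuis_at h K x a b c = 0) ->
  forall a b c, nijenhuis_at (pullback h) twistor_endo q a b c = 0.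
Proof.
move=> qx oU Ux hx qU dI dJ dK NI NJ NK a b c; subst x; set x := usubmx q in Ux hx dI dJ dK NI NJ NK *.
set u := stereo_inv e (dsubmx q).
have norm_u := stereo_inv_norm e (dsubmx q).
have ou : orthogonal_complex (twistor_u q).
  exact: (combo_orthogonal_complex (qU x Ux) norm_u).
have du := mxdiff_twistor_u dI dJ dK.
have eA : (fun v => ddir v twistor_endo q) = fun v => split_endo
   (ddir (usubmx v) (combo I J K (u (inord 0) 0) (u (inord 1) 0) (u (inord 2) 0)) x
  + quat (I x) (J x) (K x) (dstereo e (dsubmx q) (dsubmx v))) 0.
  by apply/funext => v; rewrite ddir_twistor_endo // ddir_twistor_u.
rewrite /nijenhuis_at eA.
rewrite (@nijenhuis_split _ _ (h x) _ _ _
  (fun w => ddir w (combo I J K (u (inord 0) 0) (u (inord 1) 0) (u (inord 2) 0)) x)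
  (fun t => quat (I x) (J x) (K x) (dstereo e (dsubmx q) t))) //.
- exact: (nijenhuis_combo oU Ux hx qU dI dJ dK NI NJ NK norm_u).
- by move=> a' b' c'; exact: hpair_pullback.
- move=> t; rewrite dstereo_quarter_turn -[twistor_u q]/(quat (I x) (J x) (K x) u).
  by rewrite quat_mul_at ?dstereo_orth ?scale0r ?subr0 //; exact: qU.
Qed.

End TwistorNijenhuis.

Section KahlerData.
Context {R : realType} {d : nat} {M : Type} (A : atlas R d M).

(** The analytic content, in one chart, of a generalized Kaehler structure. *)
Record kahler_data (h : 'cV[R]_d -> form3 R d) (U : set 'cV[R]_d)
    (G J : 'cV[R]_d -> 'M[R]_(d + d)) : Prop := KahlerData {
  kd_metric : forall x, U x -> is_gen_metric (G x);
  kd_comm : forall x, U x -> J x *m G x = G x *m J x;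
  kd_complex : forall x, U x -> orthogonal_complex (J x);
  kd_complexG : forall x, U x -> orthogonal_complex (G x *m J x);
  kd_diffG : forall x, U x -> mxdiff G x;
  kd_diffJ : forall x, U x -> mxdiff J x;
  kd_nijenhuis : forall x, U x -> forall a b c, nijenhuis_at h J x a b c = 0;
  kd_nijenhuisG : forall x, U x -> forall a b c,
    nijenhuis_at h (fun y => G y *m J y) x a b c = 0 }.

Lemma gen_complex_data (h : form3_field A) (J : endo_field A) (i : chart A) :
  open (adom i) -> (forall x, adom i x -> alt_trilinear (h i x)) ->
  twisted_gen_complex h J ->
  [/\ smooth_mx (adom i) (J i), forall x, adom i x -> orthogonal_complex (J i x) &
    forall x, adom i x -> forall a b c, nijenhuis_at (h i) (J i) x a b c = 0].
Proof.
move=> oU hU [[[sJ _] JJ Jskew] int].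
have oJ x : adom i x -> orthogonal_complex (J i x).
  by move=> Ux; split=> [|a b]; [exact: JJ | exact: Jskew].
split => // x Ux; apply: (involutive_nijenhuis oU Ux (hU x Ux) (sJ i) oJ).
exact: (int i (adom i) oU).
Qed.

Lemma gen_kahler_data (h : form3_field A) (G J : endo_field A) (i : chart A) :
  open (adom i) -> (forall x, adom i x -> alt_trilinear (h i x)) ->
  twisted_gen_kahler h G J -> kahler_data (h i) (adom i) (G i) (J i).
Proof.
move=> oU hU [[[sG _] met] comm cJ cGJ].
have [sJ oJ nJ] := gen_complex_data oU hU cJ.
have [sGJ oGJ nGJ] := gen_complex_data oU hU cGJ.
split => //.
- move=> x Ux; have [r p _] := met i x Ux.
  have [gg sym] := kahler_involution (oJ x Ux) (oGJ x Ux) (comm i x Ux).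
  by split.
- by move=> x Ux; exact: comm.
- by move=> x Ux; exact: smooth_mxdiff (sG i) Ux.
- by move=> x Ux; exact: smooth_mxdiff sJ Ux.
Qed.

Lemma kahler_parallel (h : 'cV[R]_d -> form3 R d) (U : set 'cV[R]_d)
    (G J : 'cV[R]_d -> 'M[R]_(d + d)) x :
  open U -> U x -> alt_trilinear (h x) -> kahler_data h U G J ->
  forall v y, bismut_endo h G J x v y = 0.
Proof.
move=> oU Ux hx [m c oJ oG dG dJ N NG] v y.
exact: (bismut_endo_eq0 oU Ux hx m oJ oG c (dG x Ux) (dJ x Ux) (N x Ux) (NG x Ux)).
Qed.

End KahlerData.

Local Close Scope ring_scope.
Local Close Scope classical_set_scope.

Theorem theoremB (R : realType) (n : nat) (M : Type) (A : atlas R (4 * n) M)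
    (h : form3_field A) (G I J K : endo_field A) :
  smooth_manifold A ->
  is_form3_field h -> closed_form3 h ->
  twisted_gen_hyperkahler h G I J K ->
  twisted_integrable (twistor_form h) (twistor_structure h G I J K).
Proof.
move=> mA [hA _ _] _ [quatIJK kI kJ kK] i U oU UA.
pose D := adom i.1; have oD : open D by exact: adom_open mA i.1.
have hD x : D x -> alt_trilinear (h i.1 x) by exact: hA.
have dI := gen_kahler_data oD hD kI; have dJ := gen_kahler_data oD hD kJ.
have dK := gen_kahler_data oD hD kK.
have qD x : D x -> quaternionic (I i.1) (J i.1) (K i.1) x.
  move=> Dx; have [IJ JI] := quatIJK i.1 x Dx.
  by split => //; [exact: (kd_complex dI) | exact: (kd_complex dJ) | exact: (kd_complex dK)].
have UD q : U q -> D (usubmx q) by move=> Uq; case: (UA q Uq).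
pose W := twistor_endo (I i.1) (J i.1) (K i.1) i.2.
have WE q : U q -> twistor_structure h G I J K i q = W q.
  move=> /UD Dq; rewrite /twistor_structure hlift_eq0.
  - by rewrite fibreJE.
  - exact: qD.
  - exact: (kahler_parallel oD Dq (hD _ Dq) dI).
  - exact: (kahler_parallel oD Dq (hD _ Dq) dJ).
  - exact: (kahler_parallel oD Dq (hD _ Dq) dK).
have inW s : in_ieigen (twistor_structure h G I J K i) U s <-> in_ieigen W U s.
  by split=> es q Uq; have := es q Uq; rewrite WE.
move=> s t cs ct /inW es /inW et; apply/inW.
apply: (nijenhuis_involutive (h := pullback (h i.1)) (J := W) oU) es et => //.
- by move=> q /UD Dq; apply: pullback_trilinear; exact: hD.
- move=> q /UD Dq; apply/mxdiff_twistor_endo/mxdiff_twistor_u.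
  + exact: kd_diffJ dI _ Dq.
  + exact: kd_diffJ dJ _ Dq.
  + exact: kd_diffJ dK _ Dq.
- move=> q /UD Dq; apply: split_orthogonal_complex; last exact: quarter_turn_sq.
  exact: (combo_orthogonal_complex (qD _ Dq) (stereo_inv_norm _ _)).
- move=> q /UD Dq; refine (@nijenhuis_twistor _ _ _ _ _ _ _ D q _ erefl oD Dq (hD _ Dq) qD _ _ _ _ _ _).
  + exact: kd_diffJ dI _ Dq.
  + exact: kd_diffJ dJ _ Dq.
  + exact: kd_diffJ dK _ Dq.
  + exact: kd_nijenhuis dI _ Dq.
  + exact: kd_nijenhuis dJ _ Dq.
  + exact: kd_nijenhuis dK _ Dq.
Qed.
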